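(* Let $G$ be a Lie group and let $\mathfrak g_1^*=\mathfrak g^*$ act on $TT^*G\simeq(G\circledS\mathfrak g_1^* )\circledS(\mathfrak g_2\circledS\mathfrak g_3^* )$, with the Tulczyjew symplectic form, by $\psi_\lambda(g,\mu,\xi,\nu)=(g,\mu+\lambda,\xi,\nu)$, with momentum map $\mathbf J^{\mathfrak g_1^*}_{TT^*G}:TT^*G\to\mathfrak g$, $(g,\mu,\xi,\nu)\mapsto-\xi$. The symplectic reduction of $TT^*G$ under this action of $\mathfrak g^*$ at $\xi\in\mathfrak g$ results in the reduced space $$\big(\mathbf J^{\mathfrak g_1^*}_{TT^*G}\big)^{-1}(\xi)\big/\mathfrak g_1^*\simeq G\circledS(\mathfrak g_1^*\times\mathfrak g_3^* )\big/\mathfrak g_1^*\simeq G\circledS\mathfrak g_3^*$$ with the canonical symplectic two-form $\Omega_{G\circledS\mathfrak g_3^*}$.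
   Context: $G$ is a (finite-dimensional) Lie group with identity $e$, $\mathfrak g=T_eG$; $\mathfrak g_i,\mathfrak g_i^*$ are copies of $\mathfrak g,\mathfrak g^*$. $R_g$ is right multiplication; $\mathrm{Ad}_g=T_e(h\mapsto ghg^{-1})$, $[\xi,\eta]=\frac{d}{dt}|_{t=0}\mathrm{Ad}_{\exp t\xi}\eta$, $\langle\mathrm{ad}^*_\xi\mu,\eta\rangle=-\langle\mu,[\xi,\eta]\rangle$. $T^*G$ is identified with $G\circledS\mathfrak g^*$ by $\alpha_g\mapsto(g,T_e^*R_g\alpha_g)$; the canonical form $d\theta$ ($\theta$ the Liouville form) becomes $\Omega_{G\circledS\mathfrak g^*}$, whose value at $(g,\nu)$ on $(T_eR_ga,\delta\nu),(T_eR_g\bar a,\delta\bar\nu)$ is $\langle\delta\nu,\bar a\rangle-\langle\delta\bar\nu,a\rangle+\langle\nu,[a,\bar a]\rangle$. $TT^*G=T(G\circledS\mathfrak g^* )$ is identified with $G\times\mathfrak g_1^*\times\mathfrak g_2\times\mathfrak g_3^*$ by sending $(V_g,V_\mu)$ at $(g,\mu)$ to $(g,\mu,\xi,\nu)$, $\xi=T_gR_{g^{-1}}V_g$, $\nu=V_\mu-\mathrm{ad}^*_\xi\mu$. The Tulczyjew form $\Omega_{TT^*G}$ is the tangent (complete) lift of the canonical form of $T^*G$, transported by this map: on vectors $(T_eR_ga,\delta\mu,\delta\xi,\delta\nu)$, $(T_eR_g\bar a,\delta\bar\mu,\delta\bar\xi,\delta\bar\nu)$ at $(g,\mu,\xi,\nu)$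 it equals $\langle\delta\nu,\bar a\rangle-\langle\delta\bar\nu,a\rangle+\langle\nu,[a,\bar a]\rangle+\langle\delta\mu,\delta\bar\xi\rangle-\langle\delta\bar\mu,\delta\xi\rangle$. Momentum maps satisfy $i_{X_\lambda}\Omega=-d\langle\mathbf J,\lambda\rangle$, $X_\lambda$ the infinitesimal generator of $\lambda\in\mathfrak g^*$ (with $(\mathfrak g^* )^*=\mathfrak g$). *)

(* Defs.v *)
From HB Require Import structures.
From mathcomp Require Import all_boot all_order all_algebra.
From mathcomp Require Import all_classical all_reals all_analysis.

Set Implicit Arguments.
Unset Strict Implicit.
Unset Printing Implicit Defensive.
Import Order.TTheory GRing.Theory Num.Theory.
Import numFieldNormedType.Exports.

Local Open Scope classical_set_scope.
Local Open Scope ring_scope.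

(* C^k and C^oo maps on an open set U.  The derivative of f is taken as the map
   (x, v) |-> 'd f x v on U x E, so that one can iterate without putting a
   topology on the space of linear maps; in finite dimension (the only case used
   below) this is the usual notion of C^k. *)
Fixpoint Ck (R : realType) (k : nat) :
    forall E F : normedModType R, set E -> (E -> F) -> Prop :=
  if k is k'.+1 then fun E F U f =>
    (forall x, U x -> differentiable f x) /\
    @Ck R k' (E * E)%type F (U `*` setT) (fun z => 'd f (z.1) z.2)
  else fun E F U f => forall x, U x -> {for x, continuous f}.

Definition smooth_on (R : realType) (E F : normedModType R) (U : set E)
    (f : E -> F) : Prop :=
  forall k, Ck k U f.

(* Charts of M in the model space E, one distinguished chart around each point
   (these form the atlas).  [chart_inv p] is only meaningful on the image
   [chart p @` chart_dom p].  The tangent space T_p M is E, read in the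
   distinguished chart at p. *)
HB.mixin Record hasCharts (R : realType) (E : normedModType R) M := {
  chart_dom : M -> set M;
  chart : M -> M -> E;
  chart_inv : M -> E -> M
}.
#[short(type="chartedType")]
HB.structure Definition Charted (R : realType) (E : normedModType R) :=
  {M of hasCharts R E M}.

#[short(type="topChartedType")]
HB.structure Definition TopCharted (R : realType) (E : normedModType R) :=
  {M of Topological M & hasCharts R E M}.

HB.mixin Record isSmoothManifold (R : realType) (E : normedModType R) M
    of TopCharted R E M := {
  manifold_hausdorff : hausdorff_space M;
  manifold_second_countable : @second_countable M;
  chart_dom_open : forall p : M, open (chart_dom p : set M);
  chart_dom_self : forall p : M, (chart_dom p : set M) p;
  chart_image_open : forall p : M, open (chart p @` chart_dom p : set E);
  chartK : forall p q : M, chart_dom p q -> chart_inv p (chart p q : E) = q;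
  chart_continuous : forall p q : M, chart_dom p q ->
    {for q, continuous (chart p : M -> E)};
  chart_inv_continuous : forall p q : M, chart_dom p q ->
    {for chart p q, continuous (chart_inv p : E -> M)};
  transition_smooth : forall p q : M,
    smooth_on (chart p @` (chart_dom p `&` chart_dom q))
      (fun y : E => chart q (chart_inv p y) : E)
}.
#[short(type="manifoldType")]
HB.structure Definition SmoothManifold (R : realType) (E : normedModType R) :=
  {M of isSmoothManifold R E M & TopCharted R E M}.

HB.instance Definition _ (R : realType) (m n : nat) :=
  hasCharts.Build R 'M[R]_(m, n) 'M[R]_(m, n)
    (fun=> setT) (fun=> id) (fun=> id).

HB.instance Definition _ (R : realType) (E F : normedModType R)
    (M : chartedType E) (N : chartedType F) :=
  hasCharts.Build R (E * F)%type (M * N)%type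
    (fun p => chart_dom p.1 `*` chart_dom p.2)
    (fun p q => (chart p.1 q.1, chart p.2 q.2))
    (fun p z => (chart_inv p.1 z.1, chart_inv p.2 z.2)).

HB.instance Definition _ (R : realType) (E F : normedModType R)
    (M : topChartedType E) (N : topChartedType F) := Charted.on (M * N)%type.

Section DifferentialGeometry.
Context {R : realType}.
Implicit Types E F : normedModType R.

Definition smooth_map E F (M : topChartedType E) (N : topChartedType F)
    (f : M -> N) : Prop :=
  continuous f /\
  forall p : M,
    smooth_on (chart p @` (chart_dom p `&` f @^-1` chart_dom (f p)))
      (fun y : E => chart (f p) (f (chart_inv p y)) : F).

(* T_p f : T_p M -> T_(f p) N *)
Definition tangent_map E F (M : chartedType E) (N : chartedType F)
    (f : M -> N) (p : M) : E -> F :=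
  'd (fun y : E => chart (f p) (f (chart_inv p y)) : F) (chart p p : E).

(* (df)_p for a real-valued f *)
Definition differential E (M : chartedType E) (f : M -> R) (p : M) : E -> R :=
  'd (fun y : E => f (chart_inv p y)) (chart p p : E).

(* T_y (chart_inv p) : E -> T_(chart_inv p y) M *)
Definition coord_vector E (M : chartedType E) (p : M) (y : E) : E -> E :=
  'd (fun x : E => chart (chart_inv p y) (chart_inv p x) : E) y.

(* T_q (chart p) : T_q M -> E *)
Definition vector_coord E (M : chartedType E) (p q : M) : E -> E :=
  'd (fun x : E => chart p (chart_inv q x) : E) (chart q q : E).

Definition one_form E (M : chartedType E) := M -> E -> R.
Definition two_form E (M : chartedType E) := M -> E -> E -> R.

Definition pullback2 E F (M : chartedType E) (N : chartedType F)
    (f : M -> N) (Omega : two_form N) : two_form M :=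
  fun p u w => Omega (f p) (tangent_map f p u) (tangent_map f p w).

Definition form1_in_chart E (M : chartedType E) (theta : one_form M) (p : M)
    (y w : E) : R :=
  theta (chart_inv p y) (coord_vector p y w).

Definition form2_in_chart E (M : chartedType E) (Omega : two_form M) (p : M)
    (y u w : E) : R :=
  Omega (chart_inv p y) (coord_vector p y u) (coord_vector p y w).

(* (d theta)_p (u, w) = (d_i theta_j - d_j theta_i) u^i w^j in the chart at p *)
Definition exterior_derivative E (M : chartedType E) (theta : one_form M) :
    two_form M :=
  fun p u w => 'D_u (fun y => form1_in_chart theta p y w) (chart p p)
             - 'D_w (fun y => form1_in_chart theta p y u) (chart p p).

End DifferentialGeometry.

(* The tangent bundle TM: (p, v) is v in T_p M. *)
Definition tangent_bundle (R : realType) (E : normedModType R)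
  (M : chartedType E) : Type := (M * E)%type.

(* chart of TM at (p, v): the tangent map of the chart of M at p *)
HB.instance Definition _ (R : realType) (E : normedModType R)
    (M : chartedType E) :=
  hasCharts.Build R (E * E)%type (tangent_bundle M)
    (fun pv => chart_dom pv.1 `*` setT)
    (fun pv qw => (chart pv.1 qw.1, vector_coord pv.1 qw.1 qw.2))
    (fun pv z => (chart_inv pv.1 z.1, coord_vector pv.1 z.1 z.2)).

(* The tangent (complete) lift to TM of a two-form on M.  In the chart of TM at
   (p, v), with coordinates (x, v), it is
     v^k d_k Omega_ij dx^i dx^j + Omega_ij (dv^i dx^j + dx^i dv^j). *)
Definition complete_lift (R : realType) (E : normedModType R)
    (M : chartedType E) (Omega : two_form M) : two_form (tangent_bundle M) :=
  fun pv U W =>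
    'D_(pv.2) (fun y => form2_in_chart Omega pv.1 y U.1 W.1) (chart pv.1 pv.1)
    + Omega pv.1 U.2 W.1 + Omega pv.1 U.1 W.2.

(* <mu, xi>, the dual of 'rV_n being 'cV_n *)
Definition pairing (R : realType) (n : nat) (mu : 'cV[R]_n) (xi : 'rV[R]_n) : R :=
  (xi *m mu) 0 0.

(* the element of the dual given by a linear functional f *)
Definition covector (R : realType) (n : nat) (f : 'rV[R]_n -> R) : 'cV[R]_n :=
  \col_i f (delta_mx 0 i).

(* The cotangent bundle T^*M: (p, alpha) is alpha in T_p^* M. *)
Definition cotangent_bundle (R : realType) (n : nat)
  (M : chartedType 'rV[R]_n) : Type := (M * 'cV[R]_n)%type.

(* chart of T^*M at (p, alpha): q |-> chart p q on the base, and the inverse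
   transpose of the tangent map of [chart p] on the fibres *)
HB.instance Definition _ (R : realType) (n : nat) (M : chartedType 'rV[R]_n) :=
  hasCharts.Build R ('rV[R]_n * 'cV[R]_n)%type (cotangent_bundle M)
    (fun pa => chart_dom pa.1 `*` setT)
    (fun pa qb => (chart pa.1 qb.1,
       covector (fun z => pairing qb.2 (coord_vector pa.1 (chart pa.1 qb.1) z))))
    (fun pa z => (chart_inv pa.1 z.1,
       covector (fun v => pairing z.2 (vector_coord pa.1 (chart_inv pa.1 z.1) v)))).

(* theta_alpha (W) = <alpha, T pi W>, pi : T^*M -> M *)
Definition liouville (R : realType) (n : nat) (M : chartedType 'rV[R]_n) :
    one_form (cotangent_bundle M) :=
  fun pa W => pairing pa.2
    (tangent_map (fun qb : cotangent_bundle M => qb.1 : M) pa W).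

HB.mixin Record isLieGroup (R : realType) (n : nat) G
    of SmoothManifold R 'rV[R]_n G & Group G := {
  mulg_smooth : @smooth_map R ('rV[R]_n * 'rV[R]_n)%type 'rV[R]_n (G * G)%type G (fun x => (x.1 * x.2)%g);
  invg_smooth : @smooth_map R 'rV[R]_n 'rV[R]_n G G (fun x => (x^-1)%g)
}.
#[short(type="lieGroupType")]
HB.structure Definition LieGroup (R : realType) (n : nat) :=
  {G of isLieGroup R n G & SmoothManifold R 'rV[R]_n G & Group G}.

Section LieGroupTheory.
Context {R : realType} {n : nat} (G : lieGroupType R n).

(* T_e R_g and T_g R_(g^-1) *)
Definition TeR (g : G) : 'rV[R]_n -> 'rV[R]_n :=
  tangent_map (fun h : G => (h * g)%g : G) (1%g : G).
Definition TRV (g : G) : 'rV[R]_n -> 'rV[R]_n :=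
  tangent_map (fun h : G => (h * g^-1)%g : G) g.

Definition Ad (g : G) : 'rV[R]_n -> 'rV[R]_n :=
  tangent_map (fun h : G => (g * h * g^-1)%g : G) (1%g : G).

(* T_e (g |-> Ad_g eta) (xi), i.e. the derivative of t |-> Ad_(c t) eta at 0 along
   any curve c with c 0 = e and c' 0 = xi, such as c t = exp (t xi). *)
Definition lie_bracket (xi eta : 'rV[R]_n) : 'rV[R]_n :=
  tangent_map (fun g : G => Ad g eta) (1%g : G) xi.

Definition coad (xi : 'rV[R]_n) (mu : 'cV[R]_n) : 'cV[R]_n :=
  covector (fun eta => - pairing mu (lie_bracket xi eta)).

(* The spaces G (s) g^* and (G (s) g_1^* ) (s) (g_2 (s) g_3^* ), as manifolds. *)
Local Notation GsD := (G * 'cV[R]_n)%type.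
Local Notation TTsG := ((G * 'cV[R]_n) * ('rV[R]_n * 'cV[R]_n))%type.

(* inverse of the trivialization alpha_g |-> (g, T_e^*R_g alpha_g) of T^*G *)
Definition TsG_of_triv (x : GsD) : cotangent_bundle G :=
  (x.1, covector (fun V => pairing x.2 (TRV x.1 V))).

Definition Omega_GsD : two_form GsD :=
  pullback2 TsG_of_triv (exterior_derivative (@liouville R n G)).

(* inverse of the trivialization of T(G (s) g^* )
     (g, mu; V_g, V_mu) |-> (g, mu, xi, nu),
     xi = T_gR_(g^-1) V_g,  nu = V_mu - ad^*_xi mu *)
Definition TTsG_of_triv (x : TTsG) : tangent_bundle GsD :=
  let: ((g, mu), (xi, nu)) := x in ((g, mu), (TeR g xi, nu + coad xi mu)).

Definition Omega_TTsG : two_form TTsG :=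
  pullback2 TTsG_of_triv (complete_lift Omega_GsD).

Definition psi (lambda : 'cV[R]_n) (x : TTsG) : TTsG :=
  let: ((g, mu), (xi, nu)) := x in ((g, mu + lambda), (xi, nu)).

Definition J (x : TTsG) : 'rV[R]_n := - x.2.1.

(* inclusion of G (s) (g_1^* x g_3^* ) as the level set of J at xi, and the
   action of g_1^* on it *)
Definition level_incl (xi : 'rV[R]_n) (y : G * ('cV[R]_n * 'cV[R]_n)) : TTsG :=
  let: (g, (mu, nu)) := y in ((g, mu), (- xi, nu)).
Definition psi_level (lambda : 'cV[R]_n) (y : G * ('cV[R]_n * 'cV[R]_n)) :
    G * ('cV[R]_n * 'cV[R]_n) :=
  let: (g, (mu, nu)) := y in (g, (mu + lambda, nu)).

End LieGroupTheory.

Section Reduction.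
Context {R : realType} {n : nat}.

(* Actions of the additive group g^* = 'cV_n, with momentum maps valued in
   (g^* )^* = g = 'rV_n. *)
Definition is_smooth_action (E : normedModType R) (P : topChartedType E)
    (act : 'cV[R]_n -> P -> P) : Prop :=
  [/\ forall p, act 0 p = p,
      forall l m p, act (l + m) p = act l (act m p) &
      smooth_map (fun x : 'cV[R]_n * P => act x.1 x.2)].

Definition infinitesimal_generator (E : normedModType R) (P : chartedType E)
    (act : 'cV[R]_n -> P -> P) (lambda : 'cV[R]_n) (p : P) : E :=
  derive1 (fun t : R => chart p (act (t *: lambda) p) : E) 0.

(* i_(X_lambda) Omega = - d <J, lambda> *)
Definition is_momentum_map (E : normedModType R) (P : topChartedType E)
    (Omega : two_form P) (act : 'cV[R]_n -> P -> P) (J : P -> 'rV[R]_n) : Prop :=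
  smooth_map J /\
  forall lambda p w,
    Omega p (infinitesimal_generator act lambda p) w
    = - differential (fun q => pairing lambda (J q)) p w.

Definition orbit_of (P : Type) (act : 'cV[R]_n -> P -> P) (p : P) : set P :=
  [set act l p | l in setT].

(* J^-1(xi) / g^*: the set of orbits contained in the level set (the isotropy
   group of xi is all of the abelian group g^* ) *)
Definition reduced_space (P : Type) (act : 'cV[R]_n -> P -> P)
    (J : P -> 'rV[R]_n) (xi : 'rV[R]_n) : set (set P) :=
  [set orbit_of act p | p in J @^-1` [set xi]].

(* The symplectic reduction of (P, Omega) at xi is (B, omega): xi is a regular
   value of J, iota : L -> P embeds L onto the level set J^-1(xi), and Phi
   identifies J^-1(xi) / g^* with B in such a way that the projection
   pi : J^-1(xi) -> J^-1(xi) / g^* is a submersion and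
   iota^* Omega = pi^* omega. *)
Record is_symplectic_reduction (E E' F : normedModType R)
    (P : topChartedType E) (L : topChartedType E') (B : topChartedType F)
    (Omega : two_form P) (act : 'cV[R]_n -> P -> P) (J : P -> 'rV[R]_n)
    (xi : 'rV[R]_n) (iota : L -> P) (Phi : set P -> B) (omega : two_form B) :
    Prop := {
  level_invariant : forall l p, J p = xi -> J (act l p) = xi;
  level_regular : forall p, J p = xi ->
    forall v, exists w, tangent_map J p w = v;
  level_smooth : smooth_map iota;
  level_injective : injective iota;
  level_range : range iota = J @^-1` [set xi];
  level_topology : forall U : set L, open U ->
    exists2 V : set P, open V & U = iota @^-1` V;
  level_immersion : forall x, injective (tangent_map iota x);
  quotient_bij : set_bij (reduced_space act J xi) setT Phi;
  quotient_smooth : smooth_map (fun x => Phi (orbit_of act (iota x)));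
  quotient_submersion : forall x v,
    exists w, tangent_map (fun x => Phi (orbit_of act (iota x))) x w = v;
  reduced_form :
    pullback2 iota Omega = pullback2 (fun x => Phi (orbit_of act (iota x))) omega
}.

End Reduction.

(* Main.v *)
(** Let [rho] be the right Maurer-Cartan form, [rho_g = T_g R_(g^-1)].  In a chart of
    [T^*G] the Liouville form is [p dq], so in the right trivialization it is
    [<nu, rho>] and its differential is
    [<dnu, rho(a')> - <dnu', rho(a)> + <nu, (d rho)(a, a')>], where
    [(d rho)(a, a') = [rho a, rho a']] by the Maurer-Cartan equation.  The latter is
    obtained by writing [Ad_(y g^-1) eta] as [rho_y] applied to the derivative of
    [h |-> y g^-1 h g] at [e], differentiating in [y], and exchanging the two
    derivatives.  In the complete lift to [T(G (s) g^* )] the terms containing [mu]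
    (though not those containing [dmu]) cancel by the Maurer-Cartan equation and the
    antisymmetry and Jacobi identities of the bracket.  Hence the Tulczyjew form does not
    depend on [mu], so that [psi] is symplectic, and on a level set of [J], where
    [dxi = 0], only the canonical form of [G (s) g_3^*] is left. *)

Require Import Defs.
From HB Require Import structures.
From mathcomp Require Import all_boot all_order all_algebra.
From mathcomp Require Import all_classical all_reals all_analysis.
From mathcomp Require Import ring lra.
Import Order.TTheory GRing.Theory Num.Theory.
Import numFieldNormedType.Exports.
Local Open Scope classical_set_scope.
Local Open Scope ring_scope.

Set Implicit Arguments.
Unset Strict Implicit.
Unset Printing Implicit Defensive.

(** * Differential calculus *)

Section Calculus.
Context {R : realType}.
Implicit Types E F V W : normedModType R.

(** A tangent space is the model space read in the chart distinguished at its own point, so the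
    components of a vector field need not vary continuously with the point. Whatever is to be
    differentiated in the base point [y] is therefore transported into one fixed chart ([rho],
    [sigma]) and recognised as a partial derivative of the local representative of a single smooth
    map on the group: [h k^-1] for [rho], [h k] for its inverse, [h k h^-1] for [Ad]. The smoothness
    of that map supplies the differentiability in [y]. Such identities hold only near the base
    point, hence the constant use of germs. As the bracket is defined as the derivative of [Ad], its
    algebra has to be derived too: the invariance of the bracket under [Ad], differentiated at [e],
    is the Jacobi identity, and the antisymmetry is read off the Maurer-Cartan equation at [e],
    whose left side is visibly antisymmetric. The exchange of derivatives rests on second
    differences, under hypotheses weak enough to be met by [C2_at]. *)

Lemma near_add V (P : set V) (x : V) :
  nbhs x P -> \forall y \near 0, P (y + x).
Proof.
move=> Px; have : nbhs (0 + x) P by rewrite add0r.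
apply: (@cvgD _ _ _ (nbhs (0 : V)) _ id (cst x)); [exact: cvg_id|exact: cvg_cst].
Qed.

(** Being a differential is a little-o condition, hence depends only on the germ. This is the tool
    for replacing a map by a formula that represents it only near the base point. *)
Lemma is_diff_near V W (f g df : V -> W) (x : V) :
  (\near x, f x = g x) -> is_diff x f df -> is_diff x g df.
Proof.
move=> fg [dfx <-].
have gx : g x = f x by rewrite (nbhs_singleton fg).
have [dc fo] := (diff_locallyP x f).1 dfx.
have go : g \o shift x = cst (g x) + 'd f x +o_ 0 id.
  apply/eqaddoP => _/posnumP[e].
  have /eqaddoP/(_ _ [gt0 of e%:num]) fo' := fo.
  have fg0 := near_add fg.
  near=> y; rewrite gx; apply: le_trans (near fo' y _) => //.
  rewrite -[(g \o _ - _) y]/(g (y + x) - _) -[(f \o _ - _) y]/(f (y + x) - _).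
  by rewrite (near fg0 y).
have dg := diff_unique dc go.
split; last exact: dg.
by apply/diff_locallyP; rewrite dg.
Unshelve. all: by end_near. Qed.

Lemma near_differentiable V W (f g : V -> W) (x : V) :
  (\near x, f x = g x) -> differentiable f x -> differentiable g x.
Proof. by move=> fg /differentiableP/(is_diff_near fg) []. Qed.

Lemma near_diffE V W (f g : V -> W) (x : V) :
  (\near x, f x = g x) -> differentiable f x -> 'd f x = 'd g x :> (V -> W).
Proof. by move=> fg /differentiableP/(is_diff_near fg) []. Qed.

Lemma is_diff_linear V W (f : V -> W) (x : V) :
  linear f -> continuous f -> is_diff x f f.
Proof.
move=> lf cf.
pose fM := GRing.isLinear.Build _ _ _ _ f lf.
pose fL : {linear V -> W} := HB.pack f fM.
by split; [exact: (@linear_differentiable _ _ _ fL)|exact: (@diff_lin _ _ _ fL)].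
Qed.

Lemma is_diff_fst (E F : normedModType R) (z : E * F) : is_diff z (fst : E * F -> E) fst.
Proof. by apply: is_diff_linear => // y; exact: cvg_fst. Qed.

Lemma is_diff_snd (E F : normedModType R) (z : E * F) : is_diff z (snd : E * F -> F) snd.
Proof. by apply: is_diff_linear => // y; exact: cvg_snd. Qed.

Lemma is_diff_unique (V W : normedModType R) (f df dg : V -> W) (x v : V) :
  is_diff x f df -> is_diff x f dg -> df v = dg v.
Proof. by move=> [_ <-] [_ <-]. Qed.

Lemma is_diff_affine V W (f l : V -> W) (x : V) :
  linear l -> continuous l -> (forall y, f y = f 0 + l y) ->
  is_diff x f l.
Proof.
move=> ll cl fl; have dl := is_diff_linear x ll cl.
have -> : f = cst (f 0) + l by apply/funext.
by apply: is_diff_eq; rewrite add0r.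
Qed.

Lemma near_fst E F (P : set E) (x : E) (y : F) :
  (\forall x \near x, P x) -> \forall z \near (x, y), P z.1.
Proof. by move=> Px; exact: cvg_fst. Qed.

Lemma open_near V (U : set V) (P : V -> Prop) (x : V) :
  open U -> U x -> (forall y, U y -> P y) -> \forall y \near x, P y.
Proof. by move=> oU Ux UP; apply: filterS (open_nbhs_nbhs (conj oU Ux)). Qed.

Lemma openXT E F (U : set E) : open U -> open (U `*` [set: F]).
Proof.
move=> oU; rewrite openE => -[x y] [/= Ux _].
exists (U, setT) => /=; last by move=> [? ?].
by split; [exact: open_nbhs_nbhs|exact: filterT].
Qed.

Lemma Ck_sub k E F (U U' : set E) (f : E -> F) :
  U' `<=` U -> Ck k U f -> Ck k U' f.
Proof.
elim: k E F U U' f => [|k IH] E F U U' f sU /=; first by move=> cf x /sU/cf.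
move=> [df cf]; split; first by move=> x /sU/df.
by apply: IH cf => -[x v] [/= /sU].
Qed.

(** Openness of [U] turns agreement on [U] into agreement of germs, which passes to the
    derivatives. *)
Lemma eq_Ck k E F (U : set E) (f g : E -> F) :
  open U -> (forall x, U x -> f x = g x) -> Ck k U f -> Ck k U g.
Proof.
elim: k E F U f g => [|k IH] E F U f g oU fg.
  move=> cf x Ux; rewrite /prop_for /continuous_at -(fg x Ux).
  by apply: cvg_trans (cf x Ux); apply: near_eq_cvg; exact: (open_near oU Ux).
move=> [df cf]; split=> [x Ux|].
  by apply: near_differentiable (df x Ux); exact: (open_near oU Ux).
apply: IH cf => [|[x v] [/= Ux _]]; first exact: openXT.
by rewrite /= (near_diffE (open_near oU Ux fg) (df x Ux)).
Qed.

Lemma Ck_linear k E F (U : set E) (f : E -> F) :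
  linear f -> continuous f -> Ck k U f.
Proof.
elim: k E F U f => [|k IH] E F U f lf cf /=; first by move=> x _; exact: cf.
have df x := is_diff_linear x lf cf.
split=> [x _|]; first exact: ex_diff.
have -> : (fun z : E * E => 'd f (z.1) z.2) = (fun z => f z.2).
  by apply/funext => z; rewrite diff_val.
apply: IH => [a u v|z]; first by rewrite /= lf.
by apply: continuous_comp; [exact: cvg_snd|exact: cf].
Qed.

Lemma Ck_affine k E F (U : set E) (f l : E -> F) :
  linear l -> continuous l -> (forall y, f y = f 0 + l y) -> Ck k U f.
Proof.
case: k => [|k] ll cl fl.
  by move=> x _; apply: differentiable_continuous; have [] := is_diff_affine x ll cl fl.
split=> [x _|]; first by have [] := is_diff_affine x ll cl fl.
have -> : (fun z : E * E => 'd f (z.1) z.2) = (fun z => l z.2).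
  by apply/funext => z; have [_ ->] := is_diff_affine z.1 ll cl fl.
apply: Ck_linear => [a u v|z]; first by rewrite /= ll.
by apply: continuous_comp; [exact: cvg_snd|exact: cl].
Qed.

Lemma Ck_pred k E F (U : set E) (f : E -> F) : Ck k.+1 U f -> Ck k U f.
Proof.
elim: k E F U f => [|k IH] E F U f.
  by move=> [df _] x /df; exact: differentiable_continuous.
by move=> [df cf]; split=> //; exact: IH.
Qed.

Lemma Ck_pair k E F V (U : set E) (f : E -> F) (g : E -> V) :
  open U -> Ck k U f -> Ck k U g -> Ck k U (fun x => (f x, g x)).
Proof.
elim: k E F V U f g => [|k IH] E F V U f g oU.
  by move=> cf cg x Ux; apply: cvg_pair; [exact: cf|exact: cg].
move=> [df cf] [dg cg]; split=> [x Ux|].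
  by apply: differentiable_pair; [exact: df|exact: dg].
apply: eq_Ck (IH _ _ _ _ _ _ _ cf cg); [exact: openXT| |exact: openXT].
by move=> z [Uz _]; rewrite diff_pair; [| exact: df|exact: dg].
Qed.

(** By the chain rule the derivative of [g \o f], as a map of pairs, is that of [g] after
    [(x, v) |-> (f x, 'd f x v)], so the induction hypothesis applies again; the component [f x] is
    wanted one order lower, whence [Ck_pred]. *)
Lemma Ck_comp k E F V (U : set E) (U' : set F) (f : E -> F) (g : F -> V) :
  open U -> open U' -> (forall x, U x -> U' (f x)) ->
  Ck k U f -> Ck k U' g -> Ck k U (g \o f).
Proof.
elim: k E F V U U' f g => [|k IH] E F V U U' f g oU oU' fU.
  move=> cf cg x Ux; apply: continuous_comp; [exact: cf|exact/cg/fU].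
move=> cf' [dg cg]; have [df cf] := cf'; split=> [x Ux|].
  by apply: differentiable_comp; [exact: df|exact/dg/fU].
pose h (z : E * E) := (f z.1, 'd f (z.1) z.2).
apply: (@eq_Ck _ _ _ _ ((fun z => 'd g (z.1) z.2) \o h)); first exact: openXT.
  by move=> z [Uz _]; rewrite diff_comp//; [exact: df|exact/dg/fU].
apply: (IH _ _ _ _ (U' `*` setT)) => //; [exact: openXT|exact: openXT| |].
  by move=> z [Uz _]; split=> //; exact: fU.
apply: Ck_pair => //; first exact: openXT.
apply: (IH _ _ _ _ U fst f); [exact: openXT|by []|by move=> z []| |exact: Ck_pred].
by apply: Ck_linear => //; move=> z; exact: cvg_fst.
Qed.

Lemma is_derive_line V W (f : V -> W) (w u : V) (s : R) :
  differentiable f (w + s *: u) ->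
  is_derive s 1 (fun t : R => f (w + t *: u)) ('d f (w + s *: u) u).
Proof.
move=> df.
have dl : is_diff s (cst w + (fun t : R => t *: u)) (0 + (fun t : R => t *: u)).
  exact: is_diffD.
have dc := is_diff_comp dl (differentiableP df).
rewrite -[X in is_derive _ _ X]/(f \o (cst w + (fun t : R => t *: u))).
split; first by apply: diff_derivable; have [] := dc.
rewrite deriveE; last by have [] := dc.
by rewrite diff_val /= add0r scale1r.
Qed.

End Calculus.

(** * Symmetry of the second derivative *)

Section SecondDerivative.
Context {R : realType}.
Implicit Types V W : normedModType R.

Lemma diff_increment V W (g : V -> W) (p : V) (e : R) :
  differentiable g p -> 0 < e ->
  \forall k \near 0, `|g (k + p) - g p - 'd g p k| <= e * `|k|.
Proof.
move=> /diff_locally/eqaddoP/(_ e) H e0.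
near=> k; rewrite -addrA -opprD.
by have := near (H e0) k; apply.
Unshelve. all: by end_near. Qed.

(* The mean value theorem for [s |-> f (p + s u + h v) - f (p + s u)] on [0, h], followed
   by the differentiability at [p] of [x |-> 'd f x u]. *)
Lemma second_difference V (f : V -> R) (p u v : V) :
  (\forall x \near p, differentiable f x) ->
  differentiable (fun x => 'd f x u) p ->
  forall e : R, 0 < e -> exists2 d : R, 0 < d & forall h, 0 < h -> h < d ->
    `|(f (p + h *: u + h *: v) - f (p + h *: u) - (f (p + h *: v) - f p))
      - h ^+ 2 * 'd (fun x => 'd f x u) p v| <= e * h ^+ 2.
Proof.
move=> df dg e e0; set g := fun x => 'd f x u.
(* The summand 1 keeps [N] positive when [u] and [v] vanish. With the tolerance [e / (2 * N)], each
   of the two increments of [g] used below costs [e * h / 2]. *)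
pose N := `|u| + `|v| + 1.
have N0 : 0 < N by rewrite /N ltr_wpDl.
have e'0 : 0 < e / (2 * N) by rewrite divr_gt0// mulr_gt0.
have := near_add df; have := diff_increment dg e'0.
move=> /nbhs_ballP[d1 /= d10 H1] /nbhs_ballP[d2 /= d20 H2].
pose d := Num.min d1 d2 / N.
have d0 : 0 < d by rewrite divr_gt0// lt_min d10 d20.
exists d => // h h0 hd.
have small (s t : R) : 0 <= s <= h -> 0 <= t <= h ->
    `|s *: u + t *: v| <= h * N /\ `|s *: u + t *: v| < Num.min d1 d2.
  move=> /andP[s0 sh] /andP[t0 th].
  suff H : `|s *: u + t *: v| <= h * N.
    by split=> //; apply: le_lt_trans H _; rewrite -ltr_pdivlMr.
  apply: le_trans (ler_normD _ _) _; rewrite !normrZ !ger0_norm// /N !mulrDr mulr1.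
  rewrite -[leLHS]addr0; apply: lerD (ltW h0).
  by apply: lerD; rewrite ler_wpM2r.
have diffp (s t : R) : 0 <= s <= h -> 0 <= t <= h ->
    differentiable f (p + (s *: u + t *: v)).
  move=> hs ht; rewrite addrC; apply: H2.
  rewrite -ball_normE /= sub0r normrN.
  by apply: lt_le_trans (small s t hs ht).2 _; rewrite ge_min lexx orbT.
have incr (s t : R) : 0 <= s <= h -> 0 <= t <= h ->
    `|g (p + (s *: u + t *: v)) - g p - 'd g p (s *: u + t *: v)| <= e * h / 2.
  move=> hs ht; rewrite [p + _]addrC.
  apply: le_trans (H1 _ _) _.
    rewrite -ball_normE /= sub0r normrN.
    by apply: lt_le_trans (small s t hs ht).2 _; rewrite ge_min lexx.
  apply: le_trans (ler_wpM2l (ltW e'0) (small s t hs ht).1) _.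
  rewrite le_eqVlt; apply/orP; left; apply/eqP.
  by field; rewrite gt_eqF.
have hh : 0 <= h <= h by apply/andP; split=> //; exact: ltW.
have h00 : 0 <= (0 : R) <= h by apply/andP; split=> //; exact: ltW.
pose phi s := f (p + h *: v + s *: u) - f (p + s *: u).
pose dphi s := g (p + h *: v + s *: u) - g (p + s *: u).
have dphiE s : 0 <= s <= h -> is_derive s 1 phi (dphi s).
  move=> hs; apply: is_deriveB.
    by apply: is_derive_line; rewrite -addrA [_ *: v + _]addrC; exact: diffp.
  apply: is_derive_line; have := diffp s 0 hs h00.
  by rewrite scale0r addr0.
have [c|c|c chi] := @MVT_segment R phi dphi 0 h (ltW h0).
- by rewrite in_itv /= => /andP[c0 ch]; apply: dphiE; rewrite !ltW.
- apply: derivable_within_continuous => s; rewrite in_itv /= => hs.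
  by have [] := dphiE s hs.
rewrite subr0 => phiE.
have hc : 0 <= c <= h by move: chi; rewrite in_itv.
have I1 := incr c h hc hh; have I2 := incr c 0 hc h00.
have linD (a b : R) x y : 'd g p (a *: x + b *: y) = a * 'd g p x + b * 'd g p y.
  by rewrite linearD !linearZ.
rewrite linD in I1; rewrite linD mul0r addr0 scale0r addr0 in I2.
have {}phiE : f (p + h *: u + h *: v) - f (p + h *: u) - (f (p + h *: v) - f p)
    = dphi c * h.
  rewrite -phiE /phi scale0r !addr0 (addrAC p); ring.
rewrite {}phiE -/g.
have -> : dphi c * h - h ^+ 2 * 'd g p v = h * (dphi c - h * 'd g p v) by ring.
have -> : e * h ^+ 2 = h * (e * h) by ring.
rewrite normrM gtr0_norm// ler_pM2l//.
(* The contributions [c * 'd g p u] cancel between the two increments, so the position of the mean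
   value point [c] is irrelevant. *)
have -> : dphi c - h * 'd g p v =
    (g (p + (c *: u + h *: v)) - g p - (c * 'd g p u + h * 'd g p v))
    - (g (p + c *: u) - g p - c * 'd g p u).
  rewrite /dphi [c *: u + _]addrC addrA; ring.
apply: le_trans (ler_normB _ _) _.
by apply: le_trans (lerD I1 I2) _; rewrite -splitr.
Qed.

(** The second difference at step [h] is symmetric in [u] and [v], and [h ^+ 2] times either mixed
    derivative lies within [e / 2 * h ^+ 2] of it; it remains to divide by [h ^+ 2]. *)
Lemma diff_symm_real V (f : V -> R) (p u v : V) :
  (\forall x \near p, differentiable f x) ->
  differentiable (fun x => 'd f x u) p -> differentiable (fun x => 'd f x v) p ->
  'd (fun x => 'd f x u) p v = 'd (fun x => 'd f x v) p u.
Proof.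
move=> df du dv; apply/eqP; rewrite -subr_eq0 -normr_le0.
apply/ler_addgt0Pr => e e0; rewrite add0r.
have e20 : 0 < e / 2 by rewrite divr_gt0.
have [d d0 Hd] := second_difference v df du e20.
have [d' d'0 Hd'] := second_difference u df dv e20.
pose h := Num.min d d' / 2.
have m0 : 0 < Num.min d d' by rewrite lt_min d0.
have h0 : 0 < h by rewrite divr_gt0.
have hm : h < Num.min d d' by rewrite ltr_pdivrMr// mulr_natr mulr2n ltrDl.
have hd : h < d by apply: lt_le_trans hm _; rewrite ge_min lexx.
have hd' : h < d' by apply: lt_le_trans hm _; rewrite ge_min lexx orbT.
have I1 := Hd h h0 hd; have I2 := Hd' h h0 hd'.
have h20 : 0 < h ^+ 2 by rewrite exprn_gt0.
rewrite -(ler_pM2r h20) -[X in _ * X <= _](gtr0_norm h20) -normrM.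
have -> : e * h ^+ 2 = e / 2 * h ^+ 2 + e / 2 * h ^+ 2 by field.
apply: le_trans (lerD I2 I1); apply: le_trans (ler_normB _ _).
rewrite le_eqVlt; apply/orP; left; apply/eqP; congr `| _ |.
by rewrite (addrAC p (h *: v)); ring.
Qed.

Lemma is_diff_coord V m n (f df : V -> 'M[R]_(m, n)) (x : V) i j :
  is_diff x f df -> is_diff x (fun y => f y i j) (fun v => df v i j).
Proof.
move=> Hf; pose c (M : 'M[R]_(m, n)) : R := M i j.
have dc : is_diff (f x) c c.
  by apply: is_diff_linear => [a M N|M]; [rewrite /c !mxE|exact: coord_continuous].
exact: (is_diff_comp Hf dc).
Qed.

(** The mean value theorem behind the symmetry is for real-valued functions, so the matrix case goes
    entry by entry. *)
Lemma diff_symm V m n (f : V -> 'M[R]_(m, n)) (p u v : V) :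
  (\forall x \near p, differentiable f x) ->
  differentiable (fun x => 'd f x u) p -> differentiable (fun x => 'd f x v) p ->
  'd (fun x => 'd f x u) p v = 'd (fun x => 'd f x v) p u.
Proof.
move=> df du dv; apply/matrixP => i j.
have near_coord w : differentiable (fun x => 'd f x w) p ->
    is_diff p (fun x => 'd (fun y => f y i j) x w) (fun z => 'd (fun x => 'd f x w) p z i j).
  move=> dw; apply: is_diff_near (is_diff_coord i j (differentiableP dw)).
  near=> x; have dfx : differentiable f x by near: x.
  by have [_ ->] := is_diff_coord i j (differentiableP dfx).
have [du' eu] := near_coord u du; have [dv' ev] := near_coord v dv.
have := diff_symm_real _ du' dv'; rewrite eu ev; apply.
near=> x; have dfx : differentiable f x by near: x.
by have [] := is_diff_coord i j (differentiableP dfx).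
Unshelve. all: by end_near. Qed.

End SecondDerivative.

(** * Linear and bilinear maps on matrices, and the pairing *)

Section MatrixValuedMaps.
Context {R : realType}.
Implicit Types V W : normedModType R.

Lemma linear_sumE V W (f : V -> W) (I : finType) (F : I -> V) :
  linear f -> f (\sum_i F i) = \sum_i f (F i).
Proof.
move=> lf; pose fM := GRing.isLinear.Build _ _ _ _ f lf.
by pose fL : {linear V -> W} := HB.pack f fM; exact: (@linear_sum _ _ _ _ fL).
Qed.

Lemma linear_scaleE V W (f : V -> W) (a : R) (u : V) :
  linear f -> f (a *: u) = a *: f u.
Proof.
move=> lf; pose fM := GRing.isLinear.Build _ _ _ _ f lf.
by pose fL : {linear V -> W} := HB.pack f fM; exact: (linearZ_LR fL).
Qed.

Lemma linear_addf (V W : normedModType R) (f f' : V -> W) :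
  linear f -> linear f' -> linear (fun x => f x + f' x).
Proof. by move=> lf lf' a u v; rewrite lf lf' scalerDr addrACA. Qed.

Lemma linear_mxE m n W (f : 'M[R]_(m, n) -> W) : linear f ->
  f = (fun M => \sum_i \sum_j M i j *: f (delta_mx i j)).
Proof.
move=> lf; apply/funext => M; rewrite {1}(matrix_sum_delta M) linear_sumE//.
by apply: eq_bigr => i _; rewrite linear_sumE//; apply: eq_bigr => j _; rewrite linear_scaleE.
Qed.

Lemma continuous_sum (T : topologicalType) W (I : finType) (F : I -> T -> W) :
  (forall i, continuous (F i)) -> continuous (fun x => \sum_i F i x).
Proof. by move=> cF; apply: continuous_big => //; exact: add_continuous. Qed.

Lemma linear_mx_continuous m n W (f : 'M[R]_(m, n) -> W) :
  linear f -> continuous f.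
Proof.
move=> /linear_mxE ->; apply: continuous_sum => i; apply: continuous_sum => j M.
by apply: continuousZr_tmp; exact: (@coord_continuous R m n i j M).
Qed.

(** In finite dimension a bilinear map is continuous, being a finite sum of coordinates times linear
    maps; the product rule follows. It serves the pairing, the bracket and the coadjoint action. *)
Lemma is_diff_bilin m n p q W (B : 'M[R]_(m, n) -> 'M[R]_(p, q) -> W) V
    (f df : V -> 'M[R]_(m, n)) (g dg : V -> 'M[R]_(p, q)) (x : V) :
  (forall v, linear (B ^~ v)) -> (forall u, linear (B u)) ->
  is_diff x f df -> is_diff x g dg ->
  is_diff x (fun y => B (f y) (g y)) (fun v => B (df v) (g x) + B (f x) (dg v)).
Proof.
move=> Bl Br Hf Hg.
pose BM := bilinear_isBilinear.Build R _ _ W _ _ B (conj Bl Br).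
pose BL : {bilinear 'M[R]_(m, n) -> 'M[R]_(p, q) -> W} := HB.pack B BM.
have Bc : continuous (fun z => BL z.1 z.2).
  have -> : (fun z => BL z.1 z.2) =
      (fun z => \sum_i \sum_j z.1 i j *: B (delta_mx i j) z.2).
    by apply/funext => y; rewrite -[LHS]/((B ^~ y.2) y.1) {1}(linear_mxE (Bl y.2)).
  apply: continuous_sum => i; apply: continuous_sum => j z; apply: cvgZ.
    by apply: (@continuous_comp _ _ _ fst (fun M : 'M[R]_(m, n) => M i j));
      [exact: cvg_fst|exact: coord_continuous].
  by apply: (@continuous_comp _ _ _ snd (B (delta_mx i j)));
    [exact: cvg_snd|exact: linear_mx_continuous].
have dB : is_diff (f x, g x) (fun z => BL z.1 z.2)
    (fun z => BL (f x) z.2 + BL z.1 (g x)).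
  by split; [exact: differentiable_bilin|exact: diff_bilin].
apply: is_diff_eq (is_diff_comp (is_diff_pair Hf Hg) dB) _.
by apply/funext => v; rewrite /= addrC.
Qed.

Lemma is_diff_mx V m n (f df : V -> 'M[R]_(m, n)) (x : V) :
  (forall i j, is_diff x (fun y => f y i j) (fun v => df v i j)) ->
  is_diff x f df.
Proof.
move=> H.
have E (h : V -> 'M[R]_(m, n)) :
    h = \sum_i \sum_j (( *:%R^~ (delta_mx i j)) \o (fun v => h v i j)).
  apply/funext => v; rewrite [LHS]matrix_sum_delta fct_sumE.
  by apply: eq_bigr => i _; rewrite fct_sumE.
rewrite (E f) (E df).
elim/big_rec2 : _ => [|i df1 f1 _ H1]; first exact: is_diff_cst.
apply: is_diffD H1; elim/big_rec2 : _ => [|j df2 f2 _ H2]; first exact: is_diff_cst.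
apply: is_diffD H2; apply: is_diff_comp (H i j) _; exact: is_diff_scalel.
Qed.

Context {n : nat}.
Implicit Types (mu nu : 'cV[R]_n) (xi eta : 'rV[R]_n).

Lemma pairingE mu xi : pairing mu xi = \sum_i xi 0 i * mu i 0.
Proof. by rewrite /pairing mxE. Qed.

Lemma pairing_linear_r mu : linear (pairing mu).
Proof. by move=> a xi eta; rewrite /pairing mulmxDl -scalemxAl !mxE. Qed.

Lemma pairing_linear_l xi : linear (fun mu => pairing mu xi : R).
Proof. by move=> a mu nu; rewrite /pairing mulmxDr -scalemxAr !mxE. Qed.

Lemma pairingDl mu nu xi : pairing (mu + nu) xi = pairing mu xi + pairing nu xi.
Proof. by have := pairing_linear_l xi 1 mu nu; rewrite !scale1r. Qed.

Lemma pairingDr mu xi eta : pairing mu (xi + eta) = pairing mu xi + pairing mu eta.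
Proof. by have := pairing_linear_r mu 1 xi eta; rewrite !scale1r. Qed.

Lemma pairingNr mu xi : pairing mu (- xi) = - pairing mu xi.
Proof. by rewrite /pairing mulNmx mxE. Qed.

Lemma pairing0l xi : pairing 0 xi = 0 :> R.
Proof. by rewrite /pairing mulmx0 mxE. Qed.

Lemma pairing0r mu : pairing mu 0 = 0 :> R.
Proof. by rewrite /pairing mul0mx mxE. Qed.

(** [covector] records [f] on the basis only; linearity recovers the other values. *)
Lemma pairing_covector (f : 'rV[R]_n -> R) xi :
  linear f -> pairing (covector f) xi = f xi.
Proof.
move=> lf; rewrite pairingE [in RHS](linear_mxE lf) big_ord1.
by apply: eq_bigr => i _; rewrite mxE.
Qed.

Lemma is_diff_pairing V (f df : V -> 'cV[R]_n) (g dg : V -> 'rV[R]_n) (x : V) :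
  is_diff x f df -> is_diff x g dg ->
  is_diff x (fun y => pairing (f y) (g y))
    (fun v => pairing (df v) (g x) + pairing (f x) (dg v)).
Proof. exact: is_diff_bilin pairing_linear_l pairing_linear_r. Qed.

Lemma is_diff_covector V (f df : V -> 'rV[R]_n -> R) (x : V) :
  (forall xi, is_diff x (f ^~ xi) (df ^~ xi)) ->
  is_diff x (fun y => covector (f y)) (fun v => covector (df v)).
Proof.
move=> H; apply: is_diff_mx => i j.
have E (h : V -> 'rV[R]_n -> R) : (fun y => covector (h y) i j) = h ^~ (delta_mx 0 i).
  by apply/funext => y; rewrite mxE.
by rewrite !E.
Qed.

End MatrixValuedMaps.

(** * Tangent maps in charts *)

Section TangentMaps.
Context {R : realType}.

(** The part of the manifold axioms on which the calculus of tangent maps rests. It holds for [G]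
    and for matrix spaces and passes to products, hence to all the trivialized spaces. *)
Class regular_charts (E : normedModType R) (M : topChartedType E) : Prop := {
  nbhs_chart_dom : forall p : M, nbhs p (chart_dom p);
  nbhs_chart_image : forall p : M, nbhs (chart p p : E) (chart p @` chart_dom p);
  chart_domK : forall p q : M, chart_dom p q -> chart_inv p (chart p q : E) = q;
  chart_inv_continuous_at :
    forall p : M, {for chart p p : E, continuous (chart_inv p : E -> M)}
}.

#[export] Instance manifold_regular (E : normedModType R) (M : manifoldType E) :
  regular_charts M.
Proof.
split.
- by move=> p; apply: open_nbhs_nbhs; split; [exact: chart_dom_open|exact: chart_dom_self].
- move=> p; apply: open_nbhs_nbhs; split; first exact: chart_image_open.
  by exists p => //; exact: chart_dom_self.
- exact: chartK.
- by move=> p; apply: chart_inv_continuous; exact: chart_dom_self.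
Qed.

#[export] Instance matrix_regular m n :
  regular_charts ('M[R]_(m, n) : topChartedType _).
Proof.
split=> // p; first exact: filterT.
  by apply: filterS filterT => x _; exists x.
exact: cvg_id.
Qed.

#[export] Instance prod_regular (E F : normedModType R)
  (M : topChartedType E) (N : topChartedType F) :
  regular_charts M -> regular_charts N ->
  regular_charts ((M * N)%type : topChartedType (E * F)%type).
Proof.
move=> rM rN; split.
- move=> [p q]; exists (chart_dom p, chart_dom q) => //=.
  by split; exact: nbhs_chart_dom.
- move=> [p q]; exists (chart p @` chart_dom p, chart q @` chart_dom q) => /=.
    by split; exact: nbhs_chart_image.
  by move=> [x y] [/= [p' dp' <-] [q' dq' <-]]; exists (p', q').
- by move=> [p q] [p' q'] [/= dp dq]; rewrite /chart_inv/= !chart_domK.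
- move=> [p q]; apply: cvg_pair.
    apply: (@continuous_comp _ _ _ fst (chart_inv p)); first exact: cvg_fst.
    exact: chart_inv_continuous_at.
  apply: (@continuous_comp _ _ _ snd (chart_inv q)); first exact: cvg_snd.
  exact: chart_inv_continuous_at.
Qed.

Section OneManifold.
Context {E : normedModType R} {M : topChartedType E} {rM : regular_charts M}.

Lemma chart_dom_base (p : M) : chart_dom p p.
Proof. exact: nbhs_singleton (nbhs_chart_dom p). Qed.

Lemma chart_base (p : M) : chart_inv p (chart p p : E) = p.
Proof. exact: chart_domK (chart_dom_base p). Qed.

Lemma near_chart_image (p : M) :
  \forall y \near (chart p p : E), (chart p @` chart_dom p) y.
Proof. exact: nbhs_chart_image. Qed.

Lemma near_chart_inv (p : M) (P : M -> Prop) :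
  (\forall q \near p, P q) -> \forall y \near (chart p p : E), P (chart_inv p y).
Proof.
move=> HP; have := @chart_inv_continuous_at _ _ rM p.
by rewrite /prop_for /continuous_at chart_base => /(_ _ HP).
Qed.

Lemma near_chartK (p : M) :
  \forall y \near (chart p p : E), chart p (chart_inv p y) = y.
Proof.
by apply: filterS (near_chart_image p) => y [q dq <-]; rewrite chart_domK.
Qed.

End OneManifold.

Definition local_rep (E F : normedModType R) (M : chartedType E)
  (N : chartedType F) (f : M -> N) (p : M) : E -> F :=
  fun y => chart (f p) (f (chart_inv p y)).

(* The continuity of [f] ensures that [local_rep f p] reads [f] in charts near
   [chart p p]. *)
Definition tdiff (E F : normedModType R) (M : topChartedType E)
  (N : topChartedType F) (f : M -> N) (p : M) : Prop :=
  {for p, continuous f} /\ differentiable (local_rep f p : E -> F) (chart p p : E).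

(** Smoothness on some open neighbourhood in the chart, so that maps compose without keeping track
    of chart domains. *)
Definition smooth_at (E F : normedModType R) (M : topChartedType E)
  (N : topChartedType F) (f : M -> N) (p : M) : Prop :=
  {for p, continuous f} /\
  exists U, [/\ open U, U (chart p p : E) & smooth_on U (local_rep f p : E -> F)].

(** The derivative is asked to be differentiable jointly in point and vector, so that either may
    vary; holding near [c], the condition can be evaluated at moving points. *)
Definition C2_at (E F : normedModType R) (f : E -> F) (c : E) : Prop :=
  \forall x \near c, differentiable f x /\
    forall v, differentiable (fun z : E * E => 'd f (z.1) z.2) (x, v).

Lemma smooth_at_tdiff (E F : normedModType R) (M : topChartedType E)
    (N : topChartedType F) (f : M -> N) (p : M) :
  smooth_at f p -> tdiff f p.
Proof. by move=> [cf [U [oU Up /(_ 1%N) [df _]]]]; split=> //; exact: df. Qed.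

Lemma smooth_at_C2 (E F : normedModType R) (M : topChartedType E)
    (N : topChartedType F) (f : M -> N) (p : M) :
  smooth_at f p -> C2_at (local_rep f p : E -> F) (chart p p).
Proof.
move=> [_ [U [oU Up /(_ 2%N) [df [ddf _]]]]].
apply: open_near oU Up _ => y Uy; split; first exact: df.
by move=> v; apply: ddf.
Qed.

Section Composition.
Context {E F V : normedModType R} {M : topChartedType E} {N : topChartedType F}
  {P : topChartedType V} {rM : regular_charts M} {rN : regular_charts N}.

Lemma near_map_chart_inv (f : M -> N) (p : M) (Q : N -> Prop) :
  {for p, continuous f} -> (\forall q \near f p, Q q) ->
  \forall y \near (chart p p : E), Q (f (chart_inv p y)).
Proof. by move=> cf HQ; exact: (@near_chart_inv _ _ rM p (Q \o f) (cf _ HQ)). Qed.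

(** The intermediate chart cancels as long as [f] stays in its domain, which continuity ensures near
    the base point. *)
Lemma near_local_rep_comp (f : M -> N) (g : N -> P) (p : M) :
  {for p, continuous f} ->
  \forall y \near (chart p p : E),
    local_rep g (f p) (local_rep f p y : F) = local_rep (g \o f) p y :> V.
Proof.
move=> cf; have H := near_map_chart_inv cf (@nbhs_chart_dom _ _ rN (f p)).
by near=> y; rewrite /local_rep chart_domK//; near: y.
Unshelve. all: by end_near. Qed.

Lemma local_rep_base (f : M -> N) (p : M) :
  local_rep f p (chart p p : E) = chart (f p) (f p) :> F.
Proof. by rewrite /local_rep chart_base. Qed.

Lemma tdiff_comp (f : M -> N) (g : N -> P) (p : M) :
  tdiff f p -> tdiff g (f p) -> tdiff (g \o f) p.
Proof.
move=> [cf df] [cg dg]; split; first exact: continuous_comp.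
apply: near_differentiable (near_local_rep_comp g cf) _.
by apply: differentiable_comp => //; rewrite local_rep_base.
Qed.

Lemma tangent_comp (f : M -> N) (g : N -> P) (p : M) (v : E) :
  tdiff f p -> tdiff g (f p) ->
  tangent_map (g \o f) p v = tangent_map g (f p) (tangent_map f p v).
Proof.
move=> [cf df] [cg dg].
have dg' : differentiable (local_rep g (f p)) (local_rep f p (chart p p : E) : F).
  by rewrite local_rep_base.
rewrite /tangent_map -(near_diffE (near_local_rep_comp g cf)); last exact: differentiable_comp.
by rewrite (diff_comp df dg')/= local_rep_base.
Qed.

Lemma smooth_at_comp (f : M -> N) (g : N -> P) (p : M) :
  smooth_at f p -> smooth_at g (f p) -> smooth_at (g \o f) p.
Proof.
move=> sf [cg [U' [oU' U'p sg]]]; have [cf df] := smooth_at_tdiff sf.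
move: sf => [_ [U [oU Up sf]]]; split; first exact: continuous_comp.
have H1 := near_local_rep_comp g cf.
have H2 : \forall y \near (chart p p : E), U' (local_rep f p y).
  apply: (differentiable_continuous df).
  by rewrite local_rep_base; exact: open_nbhs_nbhs.
(* The interior of [S] is the open set on which the composite of the representatives represents the
   composite, as [eq_Ck] and [Ck_comp] require. *)
pose S := [set y : E | [/\ U y, U' (local_rep f p y : F) &
  local_rep g (f p) (local_rep f p y : F) = local_rep (g \o f) p y :> V]].
have S_c : nbhs (chart p p : E) S.
  by near=> y; split; near: y; [exact: open_nbhs_nbhs|exact: H2|exact: H1].
exists S°; split; [exact: open_interior|exact: S_c|] => k.
apply: (@eq_Ck _ _ _ _ _ (local_rep g (f p) \o local_rep f p)); first exact: open_interior.
  by move=> y /interior_subset [].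
apply: (@Ck_comp _ _ _ _ _ S° U') => //; first exact: open_interior.
  by move=> y /interior_subset [].
by apply: Ck_sub (sf k) => y /interior_subset [].
Unshelve. all: by end_near. Qed.

End Composition.

Section Constructions.
Context {E F V : normedModType R} {M : topChartedType E} {N : topChartedType F}
  {P : topChartedType V} {rM : regular_charts M} {rN : regular_charts N}.

Lemma smooth_map_at (f : M -> N) (p : M) : smooth_map f -> smooth_at f p.
Proof.
move=> [cf /(_ p) sf]; split; first exact: cf.
set A := (X in smooth_on X _) in sf.
have Ap : nbhs (chart p p : E) A.
  have H1 := @near_chart_image _ _ rM p.
  have H2 : \forall y \near (chart p p : E), chart_dom (f p) (f (chart_inv p y)).
    by apply: near_map_chart_inv; [exact: cf|exact: nbhs_chart_dom].
  near=> y; have [q dq yE] : (chart p @` chart_dom p) y by near: y.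
  exists q => //; split=> //; rewrite -(chart_domK dq) yE.
  by near: y.
exists A°; split; [exact: open_interior|exact: Ap|] => k.
by apply: Ck_sub (sf k); exact: interior_subset.
Unshelve. all: by end_near. Qed.

Lemma smooth_at_pair (f : M -> N) (g : M -> P) (p : M) :
  smooth_at f p -> smooth_at g p -> smooth_at (fun x => (f x, g x)) p.
Proof.
move=> [cf [U [oU Up sf]]] [cg [U' [oU' U'p sg]]]; split; first exact: cvg_pair.
exists (U `&` U'); split; [exact: openI|by []|] => k.
apply: Ck_pair; first exact: openI.
  by apply: Ck_sub (sf k) => y [].
by apply: Ck_sub (sg k) => y [].
Qed.

Lemma smooth_at_cst (q : N) (p : M) : smooth_at (fun _ => q) p.
Proof.
split; first exact: cvg_cst.
exists setT; split=> // [|k]; first exact: openT.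
apply: (@Ck_affine _ _ _ _ _ _ (fun _ => 0)) => //.
- by move=> a u v; rewrite scaler0 addr0.
- by move=> x; exact: cvg_cst.
- by move=> y; rewrite addr0.
Qed.

Lemma smooth_at_near (f : M -> N) (l : E -> F) (p : M) :
  linear l -> continuous l -> {for p, continuous f} ->
  (\forall y \near (chart p p : E), l y = local_rep f p y) -> smooth_at f p.
Proof.
move=> ll cl cf nf; split=> //.
exists [set y : E | l y = local_rep f p y]°; split; [exact: open_interior|exact: nf|] => k.
apply: (eq_Ck (f := l)); [exact: open_interior| |exact: Ck_linear].
by move=> y /interior_subset.
Qed.

End Constructions.

Section Projections.
Context {E F : normedModType R} {M : topChartedType E} {N : topChartedType F}
  {rM : regular_charts M} {rN : regular_charts N}.

Lemma smooth_at_id (p : M) : smooth_at (id : M -> M) p.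
Proof.
apply: (@smooth_at_near _ _ _ _ id id);
  [by []|by move=> z; exact: cvg_id|exact: cvg_id|].
near=> y; apply/esym; near: y; exact: near_chartK.
Unshelve. all: by end_near. Qed.

Lemma smooth_at_fst (p : M * N) : smooth_at (fst : M * N -> M) p.
Proof.
apply: (@smooth_at_near _ _ _ _ fst fst);
  [by []|by move=> z; exact: cvg_fst|exact: cvg_fst|].
near=> y; have e : chart p (chart_inv p y) = y.
  by near: y; exact: (@near_chartK _ _ (prod_regular rM rN) p).
by rewrite -[in LHS]e.
Unshelve. all: by end_near. Qed.

Lemma smooth_at_snd (p : M * N) : smooth_at (snd : M * N -> N) p.
Proof.
apply: (@smooth_at_near _ _ _ _ snd snd);
  [by []|by move=> z; exact: cvg_snd|exact: cvg_snd|].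
near=> y; have e : chart p (chart_inv p y) = y.
  by near: y; exact: (@near_chartK _ _ (prod_regular rM rN) p).
by rewrite -[in LHS]e.
Unshelve. all: by end_near. Qed.

End Projections.

Section Charts.
Context {n : nat} {M : manifoldType 'rV[R]_n}.

Lemma near_chart_dom2 (p q : M) : chart_dom p q ->
  \forall y \near (chart p q : 'rV[R]_n), (chart p @` (chart_dom p `&` chart_dom q)) y.
Proof.
move=> dq.
have H1 : nbhs (chart p q : 'rV[R]_n) (chart p @` chart_dom p).
  apply: open_nbhs_nbhs; split; first exact: chart_image_open.
  by exists q.
have H2 : \forall y \near (chart p q : 'rV[R]_n), chart_dom q (chart_inv p y).
  have := chart_inv_continuous p q dq; rewrite /prop_for /continuous_at chart_domK// => + .
  by move=> /(_ _ (@nbhs_chart_dom _ _ (manifold_regular M) q)).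
near=> y; have [r dr yE] : (chart p @` chart_dom p) y by near: y.
exists r => //; split=> //; rewrite -(chart_domK dr) yE.
by near: y.
Unshelve. all: by end_near. Qed.

(** Read in the distinguished chart at [q], the inverse chart at [p] is a transition map; the same
    argument serves the chart itself. *)
Lemma smooth_at_chart_inv (p q : M) : chart_dom p q ->
  smooth_at (chart_inv p : 'rV[R]_n -> M) (chart p q).
Proof.
move=> dq; split; first exact: chart_inv_continuous.
exists (chart p @` (chart_dom p `&` chart_dom q))°; split.
- exact: open_interior.
- exact: near_chart_dom2.
- move=> k; rewrite /local_rep chart_domK//.
  by apply: Ck_sub (transition_smooth p q k); exact: interior_subset.
Qed.

Lemma smooth_at_chart (p q : M) : chart_dom p q ->
  smooth_at (chart p : M -> 'rV[R]_n) q.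
Proof.
move=> dq; split; first exact: chart_continuous.
have A : nbhs (chart q q : 'rV[R]_n) (chart q @` (chart_dom q `&` chart_dom p)).
  have H1 := @near_chart_image _ _ (manifold_regular M) q.
  have H2 : \forall y \near (chart q q : 'rV[R]_n), chart_dom p (chart_inv q y).
    by apply: near_chart_inv; apply: open_nbhs_nbhs; split=> //; exact: chart_dom_open.
  near=> y; have [r dr yE] : (chart q @` chart_dom q) y by near: y.
  exists r => //; split=> //; rewrite -(chart_domK dr) yE.
  by near: y.
exists (chart q @` (chart_dom q `&` chart_dom p))°; split=> //.
- exact: open_interior.
- by move=> k; apply: Ck_sub (transition_smooth q p k); exact: interior_subset.
Unshelve. all: by end_near. Qed.

End Charts.
End TangentMaps.

(** * Partial derivatives and the chain rule for tangent maps *)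

Section PartialDerivatives.
Context {R : realType}.
Implicit Types E F V : normedModType R.

Lemma diff_is_linear E F (f : E -> F) (x : E) : linear ('d f x).
Proof. by move=> a u v; rewrite linearP. Qed.

Lemma diff_partial1 E F V (f : E * F -> V) (x : E) (y : F) (u : E) :
  differentiable f (x, y) -> 'd f (x, y) (u, 0) = 'd (fun x' => f (x', y)) x u.
Proof.
move=> df; have H := is_diff_pair (is_diff_id x) (is_diff_cst y x).
by have [_ ->] := is_diff_comp H (differentiableP df).
Qed.

Lemma diff_partial2 E F V (f : E * F -> V) (x : E) (y : F) (u : F) :
  differentiable f (x, y) -> 'd f (x, y) (0, u) = 'd (fun y' => f (x, y')) y u.
Proof.
move=> df; have H := is_diff_pair (is_diff_cst x y) (is_diff_id y).
by have [_ ->] := is_diff_comp H (differentiableP df).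
Qed.

End PartialDerivatives.

Section TangentMapLemmas.
Context {R : realType}.

Lemma tangent_map_from_mx m n (F : normedModType R) (N : chartedType F)
    (f : 'M[R]_(m, n) -> N) (x : 'M[R]_(m, n)) :
  tangent_map f x = 'd (fun y => chart (f x) (f y) : F) x :> (_ -> _).
Proof. reflexivity. Qed.

Lemma tangent_map_to_mx m n (E : normedModType R) (M : chartedType E)
    (f : M -> 'M[R]_(m, n)) (p : M) :
  tangent_map f p = 'd (fun y : E => f (chart_inv p y)) (chart p p : E) :> (_ -> _).
Proof. reflexivity. Qed.

Lemma near_tangent_map (E F : normedModType R) (M : topChartedType E)
    (N : topChartedType F) {rM : regular_charts M} (f g : M -> N) (p : M) (v : E) :
  tdiff f p -> (\forall x \near p, f x = g x) -> tangent_map f p v = tangent_map g p v.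
Proof.
move=> [_ df] fg; rewrite /tangent_map -(nbhs_singleton fg).
rewrite (near_diffE (g := fun y : E => chart (f p) (g (chart_inv p y)) : F) _ df)//.
by near do rewrite /local_rep; apply: filterS (near_chart_inv fg) => y ->.
Unshelve. all: by end_near. Qed.

Lemma tangent_map_id (E : normedModType R) (M : topChartedType E)
    {rM : regular_charts M} (p : M) (v : E) : tangent_map (id : M -> M) p v = v.
Proof.
rewrite /tangent_map -(near_diffE (f := id)) ?diff_val//.
by near=> y; apply/esym; near: y; exact: near_chartK.
Unshelve. all: by end_near. Qed.

(** The working form of the chain rule: the middle point [q] is a separate variable, because in a
    group it equals [f p] only after rewriting, and the composite may be simplified to any [k] with
    the same germ. *)
Lemma tangent_compE (E F V : normedModType R) (M : topChartedType E)
    (N : topChartedType F) (P : topChartedType V) {rM : regular_charts M}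
    {rN : regular_charts N} (f : M -> N) (g : N -> P) (k : M -> P) (p : M) (q : N) (v : E) :
  f p = q -> tdiff f p -> tdiff g q -> (\forall x \near p, g (f x) = k x) ->
  tangent_map g q (tangent_map f p v) = tangent_map k p v.
Proof.
move=> <- df dg gfk; rewrite -tangent_comp//; apply: near_tangent_map => //.
exact: tdiff_comp.
Qed.

End TangentMapLemmas.

(** * The Maurer-Cartan equation *)

Section SmoothGroupMaps.
Context {R : realType} {n : nat} (G : lieGroupType R n).
Implicit Types (g h k p q : G) (x y v w xi eta : 'rV[R]_n).

Lemma smooth_at_mul (E : normedModType R) (M : topChartedType E)
    {rM : regular_charts M} (f f' : M -> G) (p : M) :
  smooth_at f p -> smooth_at f' p -> smooth_at (fun z => (f z * f' z)%g : G) p.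
Proof.
move=> sf sf'.
have sm : smooth_at (fun z : G * G => (z.1 * z.2)%g : G) (f p, f' p).
  by apply: smooth_map_at; exact: mulg_smooth.
exact: (smooth_at_comp (smooth_at_pair sf sf') sm).
Qed.

Lemma smooth_at_inv (E : normedModType R) (M : topChartedType E)
    {rM : regular_charts M} (f : M -> G) (p : M) :
  smooth_at f p -> smooth_at (fun z => (f z)^-1%g : G) p.
Proof.
move=> sf; have si : smooth_at (fun z : G => z^-1%g : G) (f p).
  by apply: smooth_map_at; exact: invg_smooth.
exact: (smooth_at_comp sf si).
Qed.

End SmoothGroupMaps.

Ltac smooth_tac := repeat first
  [ apply: smooth_at_mul | apply: smooth_at_inv | exact: smooth_at_cst
  | exact: smooth_at_id | exact: smooth_at_fst | exact: smooth_at_snd ].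

(** * Right translations and the right trivialization *)

Section Translations.
Context {R : realType} {n : nat} (G : lieGroupType R n).
Implicit Types (g h k p q : G) (x y v w xi eta : 'rV[R]_n).

Lemma near_chart_dom g : \forall y \near (chart g g : 'rV[R]_n),
  exists2 q, chart_dom g q & y = chart g q.
Proof. by apply: filterS (near_chart_image g) => y [q dq <-]; exists q. Qed.

(* The right Maurer-Cartan form and its inverse, read in the chart at [g]; [y] is the
   coordinate of the base point. *)
Definition rho g y w := TRV (chart_inv g y) (coord_vector g y w).

Definition sigma g y xi :=
  vector_coord g (chart_inv g y) (TeR (chart_inv g y) xi).

Lemma tdiff_mulr (p q : G) : tdiff (fun h : G => (h * q)%g : G) p.
Proof. by apply: smooth_at_tdiff; smooth_tac. Qed.

Lemma TRV_TeR g xi : TRV g (TeR g xi) = xi.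
Proof.
rewrite /TRV /TeR (tangent_compE (k := id)) ?mul1g ?tangent_map_id//; try exact: tdiff_mulr.
by near=> h; rewrite mulgK.
Unshelve. all: by end_near. Qed.

Lemma TeR_TRV g w : TeR g (TRV g w) = w.
Proof.
rewrite /TRV /TeR (tangent_compE (k := id)) ?mulgV ?tangent_map_id//; try exact: tdiff_mulr.
by near=> h; rewrite mulgVK.
Unshelve. all: by end_near. Qed.

Lemma rho_linear g y : linear (rho g y).
Proof. by move=> a u v; rewrite /rho [coord_vector _ _ _]diff_is_linear [LHS]diff_is_linear. Qed.

Lemma sigma_linear g y : linear (sigma g y).
Proof. by move=> a u v; rewrite /sigma [TeR _ _]diff_is_linear [LHS]diff_is_linear. Qed.

End Translations.

Section RightTrivialization.
Context {R : realType} {n : nat} (G : lieGroupType R n).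
Implicit Types (g h k p q : G) (w xi eta : 'rV[R]_n).

Local Notation "''c_' g" := (chart g g : 'rV[R]_n) (at level 0, g at level 0).

Lemma tdiff_chart_inv g q : chart_dom g q ->
  tdiff (chart_inv g : 'rV[R]_n -> G) (chart g q).
Proof. by move=> dq; apply: smooth_at_tdiff; exact: smooth_at_chart_inv. Qed.

Lemma tdiff_chart g q : chart_dom g q -> tdiff (chart g : G -> 'rV[R]_n) q.
Proof. by move=> dq; apply: smooth_at_tdiff; exact: smooth_at_chart. Qed.

Lemma near_chart_domG g q : chart_dom g q -> \forall r \near q, chart_dom g r.
Proof. by move=> dq; apply: open_nbhs_nbhs; split=> //; exact: chart_dom_open. Qed.

Lemma coord_vectorE g (y : 'rV[R]_n) w :
  coord_vector g y w = tangent_map (chart_inv g : 'rV[R]_n -> G) y w.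
Proof. by []. Qed.

Lemma vector_coordE g q w :
  vector_coord g q w = tangent_map (chart g : G -> 'rV[R]_n) q w.
Proof. by []. Qed.

Lemma vector_coordK g q w : chart_dom g q ->
  coord_vector g (chart g q) (vector_coord g q w) = w.
Proof.
move=> dq; rewrite -[RHS](@tangent_map_id _ _ G _ q).
apply: (@tangent_compE _ _ _ _ G 'rV[R]_n G _ _ (chart g) (chart_inv g) id q _ w) => //.
- exact: tdiff_chart.
- exact: tdiff_chart_inv.
- by apply: filterS (near_chart_domG dq) => r dr; rewrite chart_domK.
Qed.

Lemma coord_vectorK g q w : chart_dom g q ->
  vector_coord g q (coord_vector g (chart g q) w) = w.
Proof.
move=> dq; rewrite -[RHS](@tangent_map_id _ _ 'rV[R]_n _ (chart g q)).
apply: (@tangent_compE _ _ _ _ 'rV[R]_n G 'rV[R]_n _ _ (chart_inv g) (chart g) id _ _ w).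
- exact: chart_domK.
- exact: tdiff_chart_inv.
- exact: tdiff_chart.
- apply: filterS (near_chart_dom2 dq) => y [r [dr _] <-].
  by rewrite chart_domK.
Qed.

(** Differentiating [h k^-1] in [h] on the diagonal gives [rho], and differentiating [h k] in [h] at
    [h = e] gives [sigma]. This exhibits both, whose definitions use charts varying with the point,
    through one smooth function each. *)
Definition divg_rep g : 'rV[R]_n * 'rV[R]_n -> 'rV[R]_n :=
  fun z => chart (1%g : G) (chart_inv g z.1 * (chart_inv g z.2)^-1)%g.

Definition mulg_rep g : 'rV[R]_n * 'rV[R]_n -> 'rV[R]_n :=
  fun z => chart g (chart_inv (1%g : G) z.1 * chart_inv g z.2)%g.

Lemma C2_divg g : C2_at (divg_rep g) ('c_g, 'c_g).
Proof.
have s : smooth_at (fun z : G * G => (z.1 * z.2^-1)%g : G) (g, g) by smooth_tac.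
by have := smooth_at_C2 s; rewrite /local_rep /= mulgV.
Qed.

Lemma C2_mulg g : C2_at (mulg_rep g) ('c_(1%g : G), 'c_g).
Proof.
have s : smooth_at (fun z : G * G => (z.1 * z.2)%g : G) (1%g : G, g) by smooth_tac.
by have := smooth_at_C2 s; rewrite /local_rep /= mul1g.
Qed.

Lemma near_diag (E F : normedModType R) (s : E -> F) (c : E) (P : F -> Prop) :
  {for c, continuous s} -> (\forall z \near s c, P z) -> \forall y \near c, P (s y).
Proof. by move=> cs H; exact: cs. Qed.

Lemma C2_at_comp (E F V : normedModType R) (f : F -> V) (s : E -> F) (c : E) :
  C2_at f (s c) -> {for c, continuous s} ->
  \forall y \near c, differentiable f (s y) /\
    forall v : F, differentiable (fun z : F * F => 'd f (z.1) z.2) (s y, v).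
Proof. by move=> Cf cs; exact: (near_diag cs Cf). Qed.

Lemma diag_continuous (E : normedModType R) (c : E) :
  {for c, continuous (fun y : E => (y, y))}.
Proof. by apply: cvg_pair; exact: cvg_id. Qed.

Lemma pair_continuous (E F : normedModType R) (a : E) (c : F) :
  {for c, continuous (pair a)}.
Proof. by apply: cvg_pair; [exact: cvg_cst|exact: cvg_id]. Qed.

Lemma pairr_continuous (E F : normedModType R) (a : F) (c : E) :
  {for c, continuous (fun y : E => (y, a))}.
Proof. by apply: cvg_pair; [exact: cvg_id|exact: cvg_cst]. Qed.

Lemma near_rhoE g : \forall y \near 'c_g,
  forall w, rho g y w = 'd (divg_rep g) (y, y) (w, 0).
Proof.
have H1 := near_chart_dom g.
have H2 := C2_at_comp (C2_divg g) (@diag_continuous _ 'c_g).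
near=> y => w; rewrite diff_partial1; last by have [] := near H2 y.
have [q dq ->] : exists2 q, chart_dom g q & y = chart g q by near: y.
rewrite /rho chart_domK// coord_vectorE.
transitivity (tangent_map (fun x => (chart_inv g x * q^-1)%g : G) (chart g q : 'rV[R]_n) w).
  apply: tangent_compE; [exact: chart_domK|exact: tdiff_chart_inv|exact: tdiff_mulr|exact: filterE].
have -> : (fun x => divg_rep g (x, chart g q)) =
    (fun x => chart (1%g : G) (chart_inv g x * q^-1)%g : 'rV[R]_n).
  by apply/funext => x; rewrite /divg_rep /= chart_domK.
rewrite tangent_map_from_mx (chart_domK dq) mulgV; reflexivity.
Unshelve. all: by end_near. Qed.

Lemma near_sigmaE g : \forall y \near 'c_g,
  forall xi, sigma g y xi = 'd (mulg_rep g) ('c_(1%g : G), y) (xi, 0).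
Proof.
have H1 := near_chart_dom g.
have H2 := C2_at_comp (C2_mulg g) (@pair_continuous _ _ 'c_(1%g : G) 'c_g).
near=> y => xi; rewrite diff_partial1; last by have [] := near H2 y.
have [q dq ->] : exists2 q, chart_dom g q & y = chart g q by near: y.
rewrite /sigma chart_domK// vector_coordE.
transitivity (tangent_map (fun h => chart g (h * q)%g : 'rV[R]_n) (1%g : G) xi).
  apply: tangent_compE; [exact: mul1g|exact: tdiff_mulr|exact: tdiff_chart|exact: filterE].
have -> : (fun x => mulg_rep g (x, chart g q)) =
    (fun x => chart g (chart_inv (1%g : G) x * q)%g : 'rV[R]_n).
  by apply/funext => x; rewrite /mulg_rep /= chart_domK.
rewrite tangent_map_to_mx; reflexivity.
Unshelve. all: by end_near. Qed.

Lemma near_partial_diff (E F V : normedModType R) (f : E * F -> V)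
    (s : E -> E * F) (phi : E -> E -> V) (c : E) :
  C2_at f (s c) -> (forall y : E, differentiable s y) ->
  (\forall y \near c, forall w : E, phi y w = 'd f (s y) (w, 0)) ->
  \forall y \near c, forall w : E, differentiable (fun z : E * E => phi z.1 z.2) (y, w).
Proof.
move=> Cf ds H.
(* To differentiate at a nearby [y] the formula for [phi] is needed on a neighbourhood of that [y],
   not just at it. *)
have H1 := near_join H.
have H2 := C2_at_comp Cf (differentiable_continuous (ds c)).
near=> y => w.
pose t (z : E * E) := (s z.1, (z.2, 0 : F)).
apply: (near_differentiable (f := (fun z => 'd f (z.1) z.2) \o t)).
  have Hy : \forall y' \near y, forall w : E, phi y' w = 'd f (s y') (w, 0) by near: y.
  by apply: filterS (near_fst w Hy) => z ->.
apply: differentiable_comp; last first.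
  have Hy : forall v : (E * F)%type,
      differentiable (fun z => 'd f (z.1) z.2) (s y, v).
    by near: y; apply: filterS H2 => y [].
  exact: Hy.
have d1 := is_diff_fst (y, w); have d2 := is_diff_snd (y, w).
rewrite /t; apply: differentiable_pair; last exact: differentiable_pair.
by apply: (@differentiable_comp _ _ _ _ fst s) => //; exact: ds.
Unshelve. all: by end_near. Qed.

Lemma near_rho_diff g : \forall y \near 'c_g,
  forall w, differentiable (fun z : 'rV[R]_n * 'rV[R]_n => rho g z.1 z.2) (y, w).
Proof.
by apply: (near_partial_diff (C2_divg g)) (near_rhoE g) => y; exact: differentiable_pair.
Qed.

Lemma near_sigma_diff g : \forall y \near 'c_g,
  forall w, differentiable (fun z : 'rV[R]_n * 'rV[R]_n => sigma g z.1 z.2) (y, w).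
Proof.
by apply: (near_partial_diff (C2_mulg g)) (near_sigmaE g) => y; exact: differentiable_pair.
Qed.

Lemma near_rho_sigma g : \forall y \near 'c_g, forall xi, rho g y (sigma g y xi) = xi.
Proof.
apply: filterS (near_chart_dom g) => y [q dq ->] xi.
by rewrite /rho /sigma chart_domK// vector_coordK// TRV_TeR.
Qed.

Lemma coord_vector_base g w : coord_vector g 'c_g w = w.
Proof.
rewrite /coord_vector chart_base -(near_diffE (f := id)); last by [].
  by rewrite diff_val.
by apply: filterS (near_chart_dom g) => y [q dq ->]; rewrite chart_domK.
Qed.

Lemma vector_coord_base g w : vector_coord g g w = w.
Proof. by rewrite -[in LHS](coord_vector_base g w) coord_vectorK//; exact: chart_dom_base. Qed.

Lemma rho_base g w : rho g 'c_g w = TRV g w.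
Proof. by rewrite /rho chart_base coord_vector_base. Qed.

Lemma sigma_base g xi : sigma g 'c_g xi = TeR g xi.
Proof. by rewrite /sigma chart_base vector_coord_base. Qed.

Lemma is_diff_rho_l g w :
  is_diff 'c_g (fun y => rho g y w) ('d (fun y => rho g y w) 'c_g).
Proof.
apply: differentiableP.
have H := nbhs_singleton (near_rho_diff g) w.
by apply: (@differentiable_comp _ _ _ _ (fun y => (y, w)) _ _ _ H); exact: differentiable_pair.
Qed.

Lemma is_diff_sigma_l g w :
  is_diff 'c_g (fun y => sigma g y w) ('d (fun y => sigma g y w) 'c_g).
Proof.
apply: differentiableP.
have H := nbhs_singleton (near_sigma_diff g) w.
by apply: (@differentiable_comp _ _ _ _ (fun y => (y, w)) _ _ _ H); exact: differentiable_pair.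
Qed.

(** The increment splits into its base part and its vector part; since [phi b] is linear, it is its
    own derivative in the second part. *)
Lemma is_diff_joint_linear (E F V W : normedModType R) (phi : E -> F -> W)
    (f df : V -> E) (m dm : V -> F) (a : V) (b : E) :
  f a = b -> differentiable (fun z : E * F => phi z.1 z.2) (b, m a) ->
  linear (phi b) -> continuous (phi b) ->
  is_diff a f df -> is_diff a m dm ->
  is_diff a (fun z => phi (f z) (m z))
    (fun v => 'd (fun y => phi y (m a)) b (df v) + phi b (dm v)).
Proof.
move=> fab dphi lphi cphi Hf Hm; rewrite -fab in dphi lphi cphi *.
apply: is_diff_eq (is_diff_comp (is_diff_pair Hf Hm) (differentiableP dphi)) _.
apply/funext => v /=.
have -> : (df v, dm v) = (df v, 0) + (0, dm v) by congr pair; rewrite /= ?addr0 ?add0r.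
rewrite linearD diff_partial1// diff_partial2//; congr (_ + _).
by have [_ ->] := is_diff_linear (m a) lphi cphi.
Qed.

Lemma is_diff_rho (V : normedModType R) g (f df m dm : V -> 'rV[R]_n) (a : V) :
  f a = 'c_g -> is_diff a f df -> is_diff a m dm ->
  is_diff a (fun z => rho g (f z) (m z))
    (fun v => 'd (fun y => rho g y (m a)) 'c_g (df v) + TRV g (dm v)).
Proof.
move=> fa Hf Hm.
apply: is_diff_eq (is_diff_joint_linear fa (nbhs_singleton (near_rho_diff g) (m a))
  (@rho_linear _ _ _ g 'c_g) (linear_mx_continuous (@rho_linear _ _ _ g 'c_g)) Hf Hm) _.
by apply/funext => v; rewrite rho_base.
Qed.

Lemma is_diff_sigma (V : normedModType R) g (f df m dm : V -> 'rV[R]_n) (a : V) :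
  f a = 'c_g -> is_diff a f df -> is_diff a m dm ->
  is_diff a (fun z => sigma g (f z) (m z))
    (fun v => 'd (fun y => sigma g y (m a)) 'c_g (df v) + TeR g (dm v)).
Proof.
move=> fa Hf Hm.
apply: is_diff_eq (is_diff_joint_linear fa (nbhs_singleton (near_sigma_diff g) (m a))
  (@sigma_linear _ _ _ g 'c_g) (linear_mx_continuous (@sigma_linear _ _ _ g 'c_g)) Hf Hm) _.
by apply/funext => v; rewrite sigma_base.
Qed.

Lemma TRV_linear g : linear (TRV g).
Proof. by move=> a u v; rewrite -!rho_base rho_linear. Qed.

Lemma TeR_linear g : linear (TeR g).
Proof. by move=> a u v; rewrite -!sigma_base sigma_linear. Qed.

(** Obtained by differentiating [rho g y (sigma g y w) = w] at the base point. *)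
Lemma diff_rho_sigma g u w :
  'd (fun y => rho g y (TeR g w)) 'c_g u + TRV g ('d (fun y => sigma g y w) 'c_g u) = 0.
Proof.
have H := is_diff_rho (erefl 'c_g) (is_diff_id 'c_g) (is_diff_sigma_l g w).
have N : \forall y \near 'c_g, rho g y (sigma g y w) = cst w y.
  by apply: filterS (near_rho_sigma g) => y ->.
have := is_diff_unique u (is_diff_near N H) (is_diff_cst w 'c_g).
by rewrite sigma_base.
Qed.

Definition conjg_rep : 'rV[R]_n * 'rV[R]_n -> 'rV[R]_n :=
  fun z => chart (1%g : G) (chart_inv (1%g : G) z.1 * chart_inv (1%g : G) z.2 * (chart_inv
    (1%g : G) z.1)^-1)%g.

Lemma C2_conjg : C2_at conjg_rep ('c_(1%g : G), 'c_(1%g : G)).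
Proof.
have s : smooth_at (fun z : G * G => (z.1 * z.2 * z.1^-1)%g : G) (1%g : G, 1%g : G) by smooth_tac.
by have := smooth_at_C2 s; rewrite /local_rep /= mulg1 mulgV.
Qed.

Lemma tdiff_conj k : tdiff (fun h : G => (k * h * k^-1)%g : G) (1%g : G).
Proof. by apply: smooth_at_tdiff; smooth_tac. Qed.

Lemma Ad_linear k : linear (Ad k).
Proof. exact: diff_is_linear. Qed.

Lemma Ad1 eta : Ad (1%g : G) eta = eta.
Proof.
rewrite /Ad -[RHS](@tangent_map_id _ _ G _ (1%g : G)); apply: near_tangent_map;
  first exact: tdiff_conj.
by apply: filterE => h; rewrite mul1g invg1 mulg1.
Qed.

Lemma Ad_mul g h eta : Ad (g * h)%g eta = Ad g (Ad h eta).
Proof.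
apply/esym; apply: tangent_compE; [by rewrite mulg1 mulgV|exact: tdiff_conj|exact: tdiff_conj|].
by apply: filterE => k; rewrite invgM !mulgA.
Qed.

(** All conjugations fix [e], so [Ad] at varying points is read in one chart as a partial derivative
    of one smooth function, hence is differentiable. *)
Lemma near_AdE : \forall y \near 'c_(1%g : G), forall eta,
  Ad (chart_inv (1%g : G) y) eta = 'd conjg_rep (y, 'c_(1%g : G)) (0, eta).
Proof.
have H := C2_at_comp C2_conjg (@pairr_continuous _ _ 'c_(1%g : G) 'c_(1%g : G));
  apply: filterS H => y [dy _] eta.
rewrite (diff_partial2 _ dy) /Ad /tangent_map mulg1 mulgV; reflexivity.
Qed.

Lemma is_diff_Ad eta :
  is_diff 'c_(1%g : G) (fun y => Ad (chart_inv (1%g : G) y) eta) (fun xi => lie_bracket G xi eta).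
Proof.
split; last by rewrite /lie_bracket tangent_map_to_mx.
have [_ /(_ (0, eta)) H] := nbhs_singleton C2_conjg.
apply: (near_differentiable (f := fun y => 'd conjg_rep (y, 'c_(1%g : G)) (0, eta))).
  by apply: filterS near_AdE => y ->.
apply: (@differentiable_comp _ _ _ _ (fun y : 'rV[R]_n => ((y, 'c_(1%g : G)), (0 : 'rV[R]_n,
  eta)))) H.
by do ?apply: differentiable_pair.
Qed.

Lemma tdiff_Ad eta : tdiff (fun k => Ad k eta) (1%g : G).
Proof.
split; last by have [] := is_diff_Ad eta.
pose phi (y : 'rV[R]_n) := Ad (chart_inv (1%g : G) y) eta.
have H : {for 'c_(1%g : G), continuous phi}.
  by have [/differentiable_continuous] := is_diff_Ad eta.
(* Continuity of [Ad] on the group is recovered from its expression in coordinates, because near [e]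
   it is that expression after the chart. *)
have cA : {for (1%g : G), continuous (phi \o (chart (1%g : G) : G -> 'rV[R]_n))}.
  by apply: continuous_comp H; apply: chart_continuous; exact: chart_dom_base.
move: cA; rewrite /prop_for /continuous_at /= /phi chart_base => cA.
apply: cvg_trans cA; apply: near_eq_cvg.
by near=> k; rewrite /= /phi chart_domK//; near: k; exact: nbhs_chart_dom.
Unshelve. all: by end_near. Qed.

End RightTrivialization.

(** * The bracket identities and the Maurer-Cartan equation *)

Section Brackets.
Context {R : realType} {n : nat} (G : lieGroupType R n).
Implicit Types (g h k p q : G) (w xi eta : 'rV[R]_n).

Local Notation "''c_' g" := (chart g g : 'rV[R]_n) (at level 0, g at level 0).
Local Notation lb := (lie_bracket G).

Lemma bracket_linear_l eta : linear (fun xi => lb xi eta).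
Proof. exact: diff_is_linear. Qed.

(** The linearity of each [Ad g] survives differentiation in [g]. *)
Lemma bracket_linear_r xi : linear (fun eta => lb xi eta).
Proof.
move=> a eta zeta.
have D := is_diffD (is_diffZ a (is_diff_Ad G eta)) (is_diff_Ad G zeta).
have N : \forall y \near 'c_(1%g : G),
   (a \*: (fun y => Ad (chart_inv (1%g : G) y) eta) + (fun y => Ad (chart_inv (1%g : G) y)
     zeta)) y
   = Ad (chart_inv (1%g : G) y) (a *: eta + zeta).
  by apply: filterE => y; rewrite Ad_linear.
exact: (is_diff_unique xi (is_diff_Ad G (a *: eta + zeta)) (is_diff_near N D)).
Qed.

(** Differentiate [Ad (g h g^-1) (Ad g eta) = Ad g (Ad h eta)] in [h] at [e]; the linear map [Ad g]
    commutes with the derivative. *)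
Lemma bracket_Ad g xi eta : (lb (Ad g xi) (Ad g eta)) = Ad g (lb xi eta).
Proof.
rewrite -[Ad g xi]/(tangent_map (fun h : G => (g * h * g^-1)%g : G) (1%g : G) xi).
transitivity (tangent_map (fun h => Ad g (Ad h eta) : 'rV[R]_n) (1%g : G) xi).
  apply: tangent_compE.
  - by rewrite mulg1 mulgV.
  - exact: tdiff_conj.
  - exact: tdiff_Ad.
  - by apply: filterE => h; rewrite -!Ad_mul mulgVK.
have dA : tdiff (Ad g : 'rV[R]_n -> 'rV[R]_n) (Ad (1%g : G) eta).
  split; first exact: (linear_mx_continuous (@Ad_linear _ _ _ g)).
  have [] // := is_diff_linear (Ad (1%g : G) eta) (@Ad_linear _ _ _ g) (linear_mx_continuous
    (@Ad_linear _ _ _ g)).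
transitivity (tangent_map (Ad g : 'rV[R]_n -> 'rV[R]_n) (Ad (1%g : G) eta) (lb xi eta)).
  apply/esym; rewrite /lie_bracket; apply: tangent_compE.
  - reflexivity.
  - exact: tdiff_Ad.
  - exact: dA.
  - exact: filterE.
rewrite tangent_map_from_mx.
by have [_ ->] := is_diff_linear (Ad (1%g : G) eta) (@Ad_linear _ _ _ g)
  (linear_mx_continuous (@Ad_linear _ _ _ g)).
Qed.

Lemma is_diff_bracket (V : normedModType R) (f df m dm : V -> 'rV[R]_n) (x : V) :
  is_diff x f df -> is_diff x m dm ->
  is_diff x (fun y => (lb (f y) (m y))) (fun v => (lb (df v) (m x)) + (lb (f x) (dm v))).
Proof. exact: is_diff_bilin bracket_linear_l bracket_linear_r. Qed.

(** This is the derivative of [bracket_Ad] in the group element at [e], in the direction [a]. *)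
Lemma jacobi a b c : (lb a (lb b c)) = (lb (lb a b) c) + (lb b (lb a c)).
Proof.
have D := is_diff_bracket (is_diff_Ad G b) (is_diff_Ad G c).
have N : \forall y \near 'c_(1%g : G),
   (lb (Ad (chart_inv (1%g : G) y) b) (Ad (chart_inv (1%g : G) y) c))
   = Ad (chart_inv (1%g : G) y) (lb b c).
  by apply: filterE => y; rewrite bracket_Ad.
have := is_diff_unique a (is_diff_Ad G (lb b c)) (is_diff_near N D).
by rewrite /= chart_base !Ad1.
Qed.

(** Represents [(q, h) |-> q (g^-1 h g)] at [(g, e)]. Its derivative in [h] at [e] is a
    left-invariant field in [q]; its derivative in [q] at [g] is a right-invariant field along
    [h g]. Their interplay is the bracket. *)
Definition shift_rep g : 'rV[R]_n * 'rV[R]_n -> 'rV[R]_n :=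
  fun z => chart g (chart_inv g z.1 * g^-1 * chart_inv (1%g : G) z.2 * g)%g.

Lemma C2_shift g : C2_at (shift_rep g) ('c_g, 'c_(1%g : G)).
Proof.
have s : smooth_at (fun z : G * G => (z.1 * g^-1 * z.2 * g)%g : G) (g, 1%g : G) by smooth_tac.
by have := smooth_at_C2 s; rewrite /local_rep /= mulgV !mul1g.
Qed.

(** Right translation by [q^-1] turns [q g^-1 h g] into the conjugate of [h] by [q g^-1]. *)
Lemma near_Ad_shift g eta : \forall y \near 'c_g,
  Ad (chart_inv g y * g^-1)%g eta =
  rho g y ('d (shift_rep g) (y, 'c_(1%g : G)) (0, eta)).
Proof.
have H1 := near_chart_dom g.
have H2 := C2_at_comp (C2_shift g) (@pairr_continuous _ _ _ 'c_(1%g : G) 'c_g).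
near=> y.
have dy : differentiable (shift_rep g) (y, 'c_(1%g : G)).
  by near: y; apply: filterS H2 => y [].
have [q dq yE] : exists2 q, chart_dom g q & y = chart g q by near: y.
rewrite (diff_partial2 _ dy) yE (chart_domK dq).
pose f h : G := (q * g^-1 * h * g)%g.
have f1 : f 1%g = q by rewrite /f mulg1 mulgVK.
have df : tdiff f (1%g : G) by apply: smooth_at_tdiff; rewrite /f; smooth_tac.
have E : 'd (fun y' => shift_rep g (chart g q, y')) 'c_(1%g : G) eta =
    vector_coord g q (tangent_map f (1%g : G) eta).
  have -> : (fun y' => shift_rep g (chart g q, y')) =
      (fun y => chart g (f (chart_inv (1%g : G) y))).
    by apply/funext => y'; rewrite /shift_rep /f /= (chart_domK dq).
  transitivity (tangent_map (fun h => chart g (f h) : 'rV[R]_n) (1%g : G) eta).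
    rewrite tangent_map_to_mx; reflexivity.
  apply/esym; rewrite vector_coordE; apply: tangent_compE.
  - exact: f1.
  - exact: df.
  - exact: tdiff_chart.
  - exact: filterE.
rewrite E /rho (chart_domK dq) (vector_coordK _ dq).
apply/esym; apply: tangent_compE.
- exact: f1.
- exact: df.
- exact: tdiff_mulr.
- by apply: filterE => h; rewrite /f invgM invgK !mulgA.
Unshelve. all: by end_near. Qed.

(** For fixed [h] the map [q |-> q g^-1 h g] is a right translation taking [g] to [h g], so it
    carries [u] to the value there of the right-invariant field through [u]. *)
Lemma shift_sigma g u : \forall y \near 'c_(1%g : G),
  'd (shift_rep g) ('c_g, y) (u, 0) =
  sigma g (chart g (chart_inv (1%g : G) y * g)%g) (TRV g u).
Proof.
have H2 := C2_at_comp (C2_shift g) (@pair_continuous _ _ _ 'c_g 'c_(1%g : G)).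
have cg : {for (1%g : G), continuous (fun h : G => (h * g)%g : G)}.
  by have [] := tdiff_mulr (1%g : G) g.
have dg : \forall r \near ((1%g * g)%g : G), chart_dom g r.
  by rewrite mul1g; exact: nbhs_chart_dom.
have H3 : \forall y \near 'c_(1%g : G), chart_dom g (chart_inv (1%g : G) y * g)%g.
  exact: (near_map_chart_inv cg dg).
near=> y.
have dy : differentiable (shift_rep g) ('c_g, y).
  by near: y; apply: filterS H2 => y [].
have dk : chart_dom g (chart_inv (1%g : G) y * g)%g by near: y.
rewrite (diff_partial1 _ dy); set k := chart_inv (1%g : G) y in dk *.
rewrite /sigma (chart_domK dk) vector_coordE.
transitivity (tangent_map (fun q => chart g (q * g^-1 * k * g)%g : 'rV[R]_n) g u).
  rewrite tangent_map_to_mx; reflexivity.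
apply/esym.
have E : TeR (k * g)%g (TRV g u) = tangent_map (fun q => (q * g^-1 * k * g)%g : G) g u.
  apply: tangent_compE; [by rewrite mulgV|exact: tdiff_mulr|exact: tdiff_mulr|].
  by apply: filterE => h; rewrite !mulgA.
rewrite E; apply: tangent_compE.
- by rewrite mulgV mul1g.
- by apply: smooth_at_tdiff; smooth_tac.
- exact: tdiff_chart.
- exact: filterE.
Unshelve. all: by end_near. Qed.

Lemma shift_base g w : 'd (shift_rep g) ('c_g, 'c_(1%g : G)) (0, TRV g w) = w.
Proof.
have [dy _] := nbhs_singleton (C2_shift g).
rewrite (diff_partial2 _ dy) -[RHS](TeR_TRV g); set eta := TRV g w.
have -> : (fun y' => shift_rep g ('c_g, y')) =
    (fun y => chart g (chart_inv (1%g : G) y * g)%g : 'rV[R]_n).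
  by apply/funext => y'; rewrite /shift_rep /= chart_base mulgV mul1g.
rewrite /TeR /tangent_map mul1g; reflexivity.
Qed.

Lemma bracket_translate g u eta :
  lb (TRV g u) eta = 'd (fun y => Ad (chart_inv g y * g^-1)%g eta) 'c_g u.
Proof.
transitivity (tangent_map (fun q => Ad (q * g^-1)%g eta) g u).
  apply: tangent_compE.
  - by rewrite mulgV.
  - exact: tdiff_mulr.
  - exact: tdiff_Ad.
  - exact: filterE.
rewrite tangent_map_to_mx; reflexivity.
Qed.

(** After the exchange of derivatives the inner one is given by [shift_sigma], and only the point
    [h g] of the right-invariant field still moves. *)
Lemma diff_shift g u eta :
  'd (fun y => 'd (shift_rep g) (y, 'c_(1%g : G)) (0, eta)) 'c_g u =
  'd (fun y => sigma g y (TRV g u)) 'c_g (TeR g eta).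
Proof.
have [dM dM2] := nbhs_singleton (C2_shift g).
have D v : is_diff ('c_g, 'c_(1%g : G)) (fun z => 'd (shift_rep g) z v)
    ('d (fun z => 'd (shift_rep g) z v) ('c_g, 'c_(1%g : G))).
  apply: differentiableP.
  by apply: (@differentiable_comp _ _ _ _ (fun z => (z, v))) (dM2 v); exact: differentiable_pair.
have [dv _] := D (0, eta); have [du _] := D (u, 0).
apply: etrans (esym (diff_partial1 u dv)) _.
have dn : \forall z \near ('c_g, 'c_(1%g : G)), differentiable (shift_rep g) z.
  by apply: filterS (C2_shift g) => z [].
apply: etrans (diff_symm dn dv du) _.
apply: etrans (diff_partial2 eta du) _.
(* The coordinates of [h g]; the derivative at [e] is by definition [TeR g]. *)
pose s y : 'rV[R]_n := chart g (chart_inv (1%g : G) y * g)%g.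
have Hs : is_diff 'c_(1%g : G) s (TeR g).
  have [_ H] := tdiff_mulr (1%g : G) g.
  move: H; rewrite /local_rep /TeR /tangent_map mul1g; exact: differentiableP.
have sE : s 'c_(1%g : G) = 'c_g by rewrite /s chart_base mul1g.
have H1 := is_diff_sigma sE Hs (is_diff_cst (TRV g u) _).
have N : \forall y \near 'c_(1%g : G),
    sigma g (s y) (cst (TRV g u) y) = 'd (shift_rep g) ('c_g, y) (u, 0).
  by apply: filterS (shift_sigma g u) => y ->.
have [_ e] := is_diff_near N H1.
apply: etrans (congr1 (fun f : 'rV[R]_n -> 'rV[R]_n => f eta) e) _.
have T0 : TeR g 0 = 0.
  by rewrite -[X in TeR g X](scale0r eta) (linear_scaleE _ _ (@TeR_linear _ _ _ g)) scale0r.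
by rewrite -[X in _ + X]/(TeR g 0) T0 addr0.
Qed.

(** The product rule applied to [near_Ad_shift] yields the first term and the image under [TRV g] of
    a mixed derivative. By [diff_shift] the latter is a derivative of [sigma] along [w], which
    [diff_rho_sigma] converts into minus a derivative of [rho]. *)
Lemma maurer_cartan g u w :
  'd (fun y => rho g y w) 'c_g u - 'd (fun y => rho g y u) 'c_g w
  = lb (TRV g u) (TRV g w).
Proof.
rewrite bracket_translate.
have dm : is_diff 'c_g (fun y => 'd (shift_rep g) (y, 'c_(1%g : G)) (0, TRV g w))
   ('d (fun y => 'd (shift_rep g) (y, 'c_(1%g : G)) (0, TRV g w)) 'c_g).
  apply: differentiableP; have [_ dM2] := nbhs_singleton (C2_shift g).
  apply: (@differentiable_comp _ _ _ _ (fun y => ((y, 'c_(1%g : G)), (0 : 'rV[R]_n,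
    TRV g w)))) (dM2 _).
  by apply: differentiable_pair => //; exact: differentiable_pair.
have H := is_diff_rho (erefl 'c_g) (is_diff_id 'c_g) dm.
have N : \forall y \near 'c_g, rho g y ('d (shift_rep g) (y, 'c_(1%g : G)) (0, TRV g w))
    = Ad (chart_inv g y * g^-1)%g (TRV g w).
  by apply: filterS (near_Ad_shift g (TRV g w)) => y ->.
have [_ e] := is_diff_near N H.
apply: etrans (esym (congr1 (fun f : 'rV[R]_n -> 'rV[R]_n => f u) e)).
have r : 'd (fun y => 'd (shift_rep g) (y, 'c_(1%g : G)) (0, TRV g w)) 'c_g u =
    'd (fun y => sigma g y (TRV g u)) 'c_g w.
  by apply: etrans (diff_shift g u (TRV g w)) _; rewrite TeR_TRV.
apply: etrans (esym (congr2 (fun X Y => 'd (fun y => rho g y X) 'c_g u + TRV g Y)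
  (shift_base g w) r)).
apply: congr1; have := diff_rho_sigma g w (TRV g u); rewrite TeR_TRV => /eqP.
by rewrite addrC addr_eq0 => /eqP ->.
Qed.

Lemma bracket_anti xi eta : lb xi eta = - lb eta xi.
Proof.
have E a b := etrans (maurer_cartan (1%g : G) (TeR 1%g a) (TeR 1%g b))
  (congr2 lb (TRV_TeR 1%g a) (TRV_TeR 1%g b)).
exact: (etrans (esym (E xi eta)) (etrans (esym (opprB _ _)) (congr1 -%R (E eta xi)))).
Qed.

End Brackets.

(** * The canonical and the Tulczyjew forms *)

Section CanonicalForm.
Context {R : realType} {n : nat} (G : lieGroupType R n).
Implicit Types (g h k p q : G) (w xi eta : 'rV[R]_n) (mu nu : 'cV[R]_n).

Local Notation "''c_' g" := (chart g g : 'rV[R]_n) (at level 0, g at level 0).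
Local Notation lb := (lie_bracket G).

Lemma differentiable_covector (V : normedModType R) (f : V -> 'rV[R]_n -> R) (x : V) :
  (forall xi, differentiable (f ^~ xi) x) -> differentiable (fun y => covector (f y)) x.
Proof.
move=> df; have H xi := differentiableP (df xi).
by have [] := @is_diff_covector _ _ _ f (fun v xi => 'd (f ^~ xi) x v) x H.
Qed.

Lemma pairing_lin_comp nu (f : 'rV[R]_n -> 'rV[R]_n) :
  linear f -> linear (fun xi => pairing nu (f xi) : R).
Proof. by move=> lf a u v; rewrite lf pairing_linear_r. Qed.

Lemma vector_coord_linear g q : linear (vector_coord g q).
Proof. exact: diff_is_linear. Qed.

Lemma vector_coord_vector g q r z : chart_dom g r -> chart_dom q r ->
  vector_coord g r (coord_vector q (chart q r) z) =
  'd (fun y => chart g (chart_inv q y) : 'rV[R]_n) (chart q r) z.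
Proof.
move=> dg dq.
transitivity (tangent_map (fun y : 'rV[R]_n => chart g (chart_inv q y) : 'rV[R]_n)
  (chart q r) z); last reflexivity.
rewrite vector_coordE coord_vectorE; apply: tangent_compE.
- exact: chart_domK.
- exact: tdiff_chart_inv.
- exact: tdiff_chart.
- exact: filterE.
Qed.

Local Notation TsG := (cotangent_bundle G).
Local Notation VTsG := ('rV[R]_n * 'cV[R]_n)%type.

Lemma tangent_fst (p : TsG) (u : VTsG) :
  tangent_map (fun q : TsG => q.1 : G) p u = u.1.
Proof.
have N : \forall z \near (chart p p : VTsG), z.1 = chart p.1 (chart_inv p.1 z.1).
  apply: (@near_fst _ _ _ (fun y => y = chart p.1 (chart_inv p.1 y))).
  by apply: filterS (near_chart_dom p.1) => y [q dq ->]; rewrite (chart_domK dq).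
by have [_ e] := is_diff_near N (is_diff_fst _);
  exact: (congr1 (fun f : VTsG -> 'rV[R]_n => f u) e).
Qed.

(** The base component of the differential of a change of charts of the cotangent bundle can be read
    off by [is_diff_pair] only once the fibre component is known to be differentiable. *)
Lemma differentiable_cotangent_transition g q (y : VTsG) :
  chart_dom g q -> y.1 = chart g q ->
  differentiable (fun x : VTsG => covector (fun z : 'rV[R]_n =>
    pairing (covector (fun v : 'rV[R]_n =>
        pairing x.2 (vector_coord g (chart_inv g x.1) v)))
      (coord_vector q (chart q (chart_inv g x.1)) z))) y.
Proof.
move=> dq yE; apply: differentiable_covector => z.
(* The fibre component is the transpose of the differential of the transition [Psi], taken at the
   moving point [Theta x.1]; as [Psi] is twice differentiable, that differential varies
   differentiably. *)
pose Psi (v : 'rV[R]_n) : 'rV[R]_n := chart g (chart_inv q v).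
pose Theta (v : 'rV[R]_n) : 'rV[R]_n := chart q (chart_inv g v).
have N : \forall x \near y, pairing x.2 ('d Psi (Theta x.1) z) =
    pairing (covector (fun v : 'rV[R]_n =>
        pairing x.2 (vector_coord g (chart_inv g x.1) v)))
      (coord_vector q (chart q (chart_inv g x.1)) z).
  have N1 : \forall v \near y.1, (chart g @` (chart_dom g `&` chart_dom q)) v.
    by rewrite yE; exact: near_chart_dom2.
  have N2 := near_fst y.2 N1; rewrite -surjective_pairing in N2.
  apply: filterS N2 => x [r [dg dr] rE].
  rewrite pairing_covector; last exact/pairing_lin_comp/vector_coord_linear.
  by rewrite /Theta -rE (chart_domK dg) vector_coord_vector.
apply: near_differentiable N _.
have Tdiff : differentiable Theta y.1.
  have [_ H] := tdiff_chart_inv dq; rewrite yE.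
  by move: H; rewrite /local_rep (chart_domK dq).
have [_ /(_ z) dPsi] := nbhs_singleton (smooth_at_C2 (smooth_at_chart dq)).
have TE : Theta y.1 = chart q q by rewrite /Theta yE (chart_domK dq).
have dPT : differentiable (fun x : VTsG => 'd Psi (Theta x.1) z) y.
  apply: (@differentiable_comp _ _ _ _ (fun x : VTsG => (Theta x.1, z))
    (fun t : ('rV[R]_n * 'rV[R]_n)%type => 'd Psi (t.1) t.2)); last by rewrite /= TE.
  apply: differentiable_pair => //.
  by apply: (@differentiable_comp _ _ _ _ fst Theta) => //; have [] := is_diff_fst y.
by have [] := is_diff_pairing (is_diff_snd y) (differentiableP dPT).
Qed.

Lemma is_diff_coord_change g q : chart_dom g q ->
  is_diff (chart g q : 'rV[R]_n) (fun v => chart q (chart_inv g v) : 'rV[R]_n)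
    (coord_vector g (chart g q)).
Proof.
move=> dq; have [_ H] := tdiff_chart_inv dq.
move: H; rewrite /local_rep /coord_vector (chart_domK dq); exact: differentiableP.
Qed.

Lemma cotangent_coord_vector (p : TsG) (y w : VTsG) q :
  chart_dom p.1 q -> y.1 = chart p.1 q ->
  (coord_vector p y w).1 = coord_vector p.1 y.1 w.1.
Proof.
case: p => g a /= dq yE; rewrite yE.
have qE : chart_inv g y.1 = q by rewrite yE (chart_domK dq).
have H1 : is_diff y (fun x : VTsG => chart q (chart_inv g x.1) : 'rV[R]_n)
    (fun x => coord_vector g (chart g q) x.1).
  have := is_diff_coord_change dq; rewrite -yE => H.
  exact: (is_diff_comp (is_diff_fst y) H).
have H2 := differentiableP (differentiable_cotangent_transition dq yE).
have [_ e] := is_diff_pair H1 H2.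
have := congr1 (fun f : VTsG -> VTsG => (f w).1) e; rewrite /= => <-.
rewrite /coord_vector /chart_inv /chart /= qE; reflexivity.
Qed.

(** The fibre coordinate is transported by the inverse transpose of the tangent map of the base
    chart, which cancels against the transport of [w.1]. *)
Lemma liouville_in_chart (p : TsG) (y w : VTsG) q :
  chart_dom p.1 q -> y.1 = chart p.1 q ->
  form1_in_chart (@liouville R n G) p y w = pairing y.2 w.1.
Proof.
move=> dq yE; rewrite /form1_in_chart /liouville tangent_fst.
rewrite (cotangent_coord_vector _ dq yE) /chart_inv /=.
rewrite pairing_covector; last exact/pairing_lin_comp/vector_coord_linear.
by rewrite yE (chart_domK dq) coord_vectorK.
Qed.

Lemma exterior_derivative_liouville (p : TsG) (u w : VTsG) :
  exterior_derivative (@liouville R n G) p u w = pairing u.2 w.1 - pairing w.2 u.1.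
Proof.
have D (a b : VTsG) : 'D_a (fun y => form1_in_chart (@liouville R n G) p y b) (chart p p)
    = pairing a.2 b.1.
  have H := is_diff_pairing (is_diff_snd (chart p p : VTsG)) (is_diff_cst b.1 _).
  have N : \forall y \near (chart p p : VTsG),
      pairing y.2 (cst b.1 y) = form1_in_chart (@liouville R n G) p y b.
    have N1 : \forall y \near (chart p p : VTsG), exists2 q, chart_dom p.1 q & y.1 = chart p.1 q.
      by apply: (@near_fst _ _ _ (fun v => exists2 q, chart_dom p.1 q & v = chart p.1 q));
        exact: near_chart_dom.
    by apply: filterS N1 => y [q dq yE]; rewrite (liouville_in_chart b dq yE).
  have [df e] := is_diff_near N H.
  rewrite (deriveE _ df); apply: etrans (congr1 (fun f : VTsG -> R => f a) e) _.
  by rewrite /= pairing0r addr0.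
by rewrite /exterior_derivative !D.
Qed.

End CanonicalForm.

Section TrivializedForm.
Context {R : realType} {n : nat} (G : lieGroupType R n).
Implicit Types (g h k p q : G) (w xi eta : 'rV[R]_n) (mu nu : 'cV[R]_n).

Local Notation "''c_' g" := (chart g g : 'rV[R]_n) (at level 0, g at level 0).
Local Notation lb := (lie_bracket G).
Local Notation GsD := (G * 'cV[R]_n)%type.
Local Notation V2 := ('rV[R]_n * 'cV[R]_n)%type.

Lemma diff_rho_linear g u : linear (fun w => 'd (fun y => rho g y w) 'c_g u).
Proof.
move=> a w w'.
have D := is_diffD (is_diffZ a (is_diff_rho_l g w)) (is_diff_rho_l g w').
have N : \forall y \near 'c_g,
   (a \*: (fun y => rho g y w) + (fun y => rho g y w')) y = rho g y (a *: w + w').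
  by apply: filterE => y; rewrite rho_linear.
exact: (is_diff_unique u (is_diff_rho_l g (a *: w + w')) (is_diff_near N D)).
Qed.

Lemma is_diff_triv_covector (x : GsD) :
  is_diff (chart x x : V2)
    (fun y : V2 => covector (fun z => pairing y.2 (rho x.1 y.1 z)))
    (fun u => covector (fun z =>
       pairing u.2 (TRV x.1 z) + pairing x.2 ('d (fun y => rho x.1 y z)
         (chart x.1 x.1 : 'rV[R]_n) u.1))).
Proof.
apply: is_diff_covector => z.
have H := is_diff_rho (erefl : (chart x x : V2).1 = 'c_(x.1)) (is_diff_fst (chart x x : V2))
  (is_diff_cst z _).
apply: is_diff_eq (is_diff_pairing (is_diff_snd (chart x x : V2)) H) _.
apply/funext => u; rewrite /= rho_base.
have -> : TRV x.1 ((0 : V2 -> 'rV[R]_n) u) = 0.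
  by have := linear_scaleE 0 z (@TRV_linear _ _ _ x.1); rewrite !scale0r.
by rewrite addr0.
Qed.

(** The [coord_vector] of the cotangent chart and the [TRV] of the trivialization compose to
    [rho]. *)
Lemma TsG_of_triv_rep (x : GsD) :
  \forall y \near (chart x x : V2),
    (y.1, covector (fun z => pairing y.2 (rho x.1 y.1 z))) =
    chart (TsG_of_triv x) (TsG_of_triv (chart_inv x y)) :> V2.
Proof.
have N : \forall y \near (chart x x : V2), exists2 q, chart_dom x.1 q & y.1 = chart x.1 q.
  by apply: (@near_fst _ _ _ (fun v => exists2 q, chart_dom x.1 q & v = chart x.1 q));
    exact: near_chart_dom.
apply: filterS N => y [q dq yE].
rewrite /TsG_of_triv /chart_inv /chart /= yE (chart_domK dq); congr pair.
congr covector; apply/funext => z.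
rewrite pairing_covector; last exact/pairing_lin_comp/TRV_linear.
by rewrite /rho (chart_domK dq).
Qed.

Lemma Omega_GsDE (x : GsD) (u w : V2) :
  Omega_GsD x u w = pairing u.2 (TRV x.1 w.1) - pairing w.2 (TRV x.1 u.1)
    + pairing x.2 (lb (TRV x.1 u.1) (TRV x.1 w.1)).
Proof.
have D := is_diff_near (TsG_of_triv_rep x)
  (is_diff_pair (is_diff_fst (chart x x : V2)) (is_diff_triv_covector x)).
have E (a : V2) : tangent_map (@TsG_of_triv R n G) x a = (a.1, covector (fun z =>
       pairing a.2 (TRV x.1 z) + pairing x.2 ('d (fun y => rho x.1 y z)
         (chart x.1 x.1 : 'rV[R]_n) a.1))).
  have [_ e] := D; exact: (congr1 (fun f : V2 -> V2 => f a) e).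
have L (a : V2) : linear (fun z : 'rV[R]_n => pairing a.2 (TRV x.1 z)
    + pairing x.2 ('d (fun y => rho x.1 y z) (chart x.1 x.1 : 'rV[R]_n) a.1) : R).
  exact: linear_addf (pairing_lin_comp a.2 (@TRV_linear _ _ _ x.1))
    (pairing_lin_comp x.2 (diff_rho_linear x.1 a.1)).
rewrite /Omega_GsD /pullback2 !E exterior_derivative_liouville.
rewrite /= (pairing_covector w.1 (L u)) (pairing_covector u.1 (L w)).
have MC : pairing x.2 (lb (TRV x.1 u.1) (TRV x.1 w.1)) =
    pairing x.2 ('d (fun y => rho x.1 y w.1) (chart x.1 x.1 : 'rV[R]_n) u.1) -
    pairing x.2 ('d (fun y => rho x.1 y u.1) (chart x.1 x.1 : 'rV[R]_n) w.1).
  apply: etrans (congr1 (pairing x.2) (esym (maurer_cartan x.1 u.1 w.1))) _.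
  by rewrite pairingDr pairingNr.
rewrite MC opprD addrACA; reflexivity.
Qed.

End TrivializedForm.

(** * The complete lift and the Tulczyjew form *)

Section BracketAlgebra.
Context {R : realType} {n : nat}.

(** Here [a] stands for [TRV g A], [X] for the derivative of [rho g y A] along the velocity, and [Y]
    for the trivialized variation of the velocity. Separately [X] and [Y] involve derivatives in the
    chart, but only [X + Y] matters. The double brackets against [mu] cancel by Jacobi, those of
    [dx] and [dx'] against the coadjoint terms (one of them by antisymmetry), and the [[xi, a]]
    terms against [dm] and [dm'] likewise. *)
Lemma lifted_form_algebra (br : 'rV[R]_n -> 'rV[R]_n -> 'rV[R]_n)
    (cd : 'rV[R]_n -> 'cV[R]_n -> 'cV[R]_n) (mu nu dm dm' dn dn' : 'cV[R]_n)
    (xi dx dx' a a' X X' Y Y' : 'rV[R]_n) :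
  (forall a b c, br (a + b) c = br a c + br b c) ->
  (forall a b c, br a (b + c) = br a b + br a c) ->
  (forall a b, br a b = - br b a) ->
  (forall a b c, br a (br b c) = br (br a b) c + br b (br a c)) ->
  (forall xi mu eta, pairing (cd xi mu) eta = - pairing mu (br xi eta)) ->
  X + Y = br xi a + dx -> X' + Y' = br xi a' + dx' ->
  pairing dm X' - pairing dm' X
  + (pairing (nu + cd xi mu) (br a a') + pairing mu (br X a' + br a X'))
  + (pairing (dn + (cd dx mu + cd xi dm)) a' - pairing dm' Y + pairing mu (br Y a'))
  + (pairing dm Y' - pairing (dn' + (cd dx' mu + cd xi dm')) a + pairing mu (br a Y'))
  = pairing dn a' - pairing dn' a + pairing nu (br a a') + pairing dm dx' - pairing dm' dx.
Proof.
move=> brDl brDr br_anti br_jacobi pairing_cd e e'.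
have E1 : pairing dm X' + pairing dm Y' = pairing dm (br xi a') + pairing dm dx'.
  by rewrite -!pairingDr e'.
have E2 : pairing dm' X + pairing dm' Y = pairing dm' (br xi a) + pairing dm' dx.
  by rewrite -!pairingDr e.
have E3 : pairing mu (br X a') + pairing mu (br Y a') =
    pairing mu (br (br xi a) a') + pairing mu (br dx a').
  by rewrite -!pairingDr -!brDl e.
have E4 : pairing mu (br a X') + pairing mu (br a Y') =
    pairing mu (br a (br xi a')) + pairing mu (br a dx').
  by rewrite -(pairingDr mu (br a X')) -(pairingDr mu (br a (br xi a'))) -(brDr a X' Y')
    -(brDr a (br xi a') dx') e'.
have E5 : pairing mu (br xi (br a a')) = pairing mu (br (br xi a) a') + pairing mu (br a
  (br xi a')).
  by rewrite -pairingDr -br_jacobi.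
have E6 : pairing mu (br a dx') = - pairing mu (br dx' a).
  by rewrite (br_anti a) pairingNr.
rewrite !(pairingDl, pairing_cd) (pairingDr mu (br X a') (br a X')).
(* All bracket identities are now linear relations between pairings, which are abstracted to real
   variables. *)
move: E1 E2 E3 E4 E5 E6.
move: (pairing dm X') (pairing dm Y') (pairing dm' X) (pairing dm' Y).
move: (pairing mu (br X a')) (pairing mu (br Y a')) (pairing mu (br a X')) (pairing mu (br a Y')).
move: (pairing mu (br (br xi a) a')) (pairing mu (br a (br xi a'))) (pairing mu (br xi
  (br a a'))).
move: (pairing mu (br dx a')) (pairing mu (br a dx')) (pairing mu (br dx' a)).
move: (pairing dm (br xi a')) (pairing dm dx') (pairing dm' (br xi a)) (pairing dm' dx).
move: (pairing dn a') (pairing dn' a) (pairing nu (br a a')).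
move=> *; lra.
Qed.

End BracketAlgebra.

Section TulczyjewForm.
Context {R : realType} {n : nat} (G : lieGroupType R n).
Implicit Types (g h k p q : G) (w xi eta : 'rV[R]_n) (mu nu : 'cV[R]_n).

Local Notation "''c_' g" := (chart g g : 'rV[R]_n) (at level 0, g at level 0).
Local Notation lb := (lie_bracket G).
Local Notation GsD := (G * 'cV[R]_n)%type.
Local Notation V2 := ('rV[R]_n * 'cV[R]_n)%type.
Local Notation TTsG := ((G * 'cV[R]_n) * ('rV[R]_n * 'cV[R]_n))%type.
Local Notation V4 := (V2 * V2)%type.

Lemma coord_vector_GsD g mu (y U : V2) q :
  chart_dom g q -> y.1 = chart g q ->
  coord_vector ((g, mu) : GsD) y U = (coord_vector g y.1 U.1, U.2).
Proof.
move=> dq yE.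
have qE : chart_inv g y.1 = q by rewrite yE (chart_domK dq).
have H1 : is_diff y (fun x : V2 => chart q (chart_inv g x.1) : 'rV[R]_n)
    (fun x => coord_vector g y.1 x.1).
  have := is_diff_coord_change dq; rewrite -yE => H.
  exact: (is_diff_comp (is_diff_fst y) H).
have [_ e] := is_diff_pair H1 (is_diff_snd y).
apply: etrans (congr1 (fun f : V2 -> V2 => f U) e).
rewrite /coord_vector /chart_inv /chart /= qE; reflexivity.
Qed.

Lemma vector_coord_GsD g mu q nu (U : V2) : chart_dom g q ->
  vector_coord ((g, mu) : GsD) (q, nu) U = (vector_coord g q U.1, U.2).
Proof.
move=> dq.
have H : is_diff 'c_q (fun v => chart g (chart_inv q v) : 'rV[R]_n) (vector_coord g q).
  have [_ H] := tdiff_chart dq.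
  by move: H; rewrite /local_rep /vector_coord; exact: differentiableP.
have H1 := is_diff_comp (is_diff_fst (('c_q, nu) : V2)) H.
have [_ e] := is_diff_pair H1 (is_diff_snd _).
exact: (congr1 (fun f : V2 -> V2 => f U) e).
Qed.

Lemma near_base_chart g mu : \forall y \near (('c_g, mu) : V2),
  exists2 q, chart_dom g q & y.1 = chart g q.
Proof.
by apply: (@near_fst _ _ _ (fun v => exists2 q, chart_dom g q & v = chart g q));
  exact: near_chart_dom.
Qed.

Lemma near_form2_GsD g mu (U W : V2) : \forall y \near (('c_g, mu) : V2),
  pairing U.2 (rho g y.1 W.1) - pairing W.2 (rho g y.1 U.1)
    + pairing y.2 (lb (rho g y.1 U.1) (rho g y.1 W.1))
  = form2_in_chart (@Omega_GsD R n G) ((g, mu) : GsD) y U W.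
Proof.
apply: filterS (near_base_chart g mu) => y [q dq yE].
rewrite /form2_in_chart Omega_GsDE !(coord_vector_GsD mu _ dq yE) /chart_inv /=.
reflexivity.
Qed.

(** Removes the derivatives of the constant covectors [U.2] and [W.2] left by the product rule. *)
Lemma drop_zero_terms (a b x y c d : R) :
  a = 0 -> b = 0 -> c = d -> (a + x) - (b + y) + c = x - y + d.
Proof. by move=> -> -> ->; rewrite !add0r. Qed.

Lemma derive_form2_GsD g mu (U W v : V2) :
  'D_v (fun y => form2_in_chart (@Omega_GsD R n G) ((g, mu) : GsD) y U W)
    (chart (g, mu) ((g, mu) : GsD)) =
  pairing U.2 ('d (fun y => rho g y W.1) 'c_g v.1)
  - pairing W.2 ('d (fun y => rho g y U.1) 'c_g v.1)
  + (pairing v.2 (lb (TRV g U.1) (TRV g W.1))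
     + pairing mu (lb ('d (fun y => rho g y U.1) 'c_g v.1) (TRV g W.1)
                   + lb (TRV g U.1) ('d (fun y => rho g y W.1) 'c_g v.1))).
Proof.
have Hr (w : 'rV[R]_n) := is_diff_comp (is_diff_fst (('c_g, mu) : V2)) (is_diff_rho_l g w).
have Hp nu w := is_diff_pairing (is_diff_cst nu (('c_g, mu) : V2)) (Hr w).
have Hb := is_diff_pairing (is_diff_snd (('c_g, mu) : V2)) (is_diff_bracket G (Hr U.1) (Hr W.1)).
have H := is_diffD (is_diffB (Hp U.2 W.1) (Hp W.2 U.1)) Hb.
have [df e] := is_diff_near (near_form2_GsD g mu U W) H.
rewrite (deriveE _ df); apply: etrans (congr1 (fun f : V2 -> R => f v) e) _.
apply: drop_zero_terms; [exact: pairing0l|exact: pairing0l|].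
by rewrite /= (rho_base g W.1) (rho_base g U.1).
Qed.

Lemma coad_linear_l mu : linear (fun xi => coad G xi mu).
Proof.
move=> a xi eta; apply/matrixP => i j; rewrite !mxE bracket_linear_l.
by rewrite pairing_linear_r opprD mulrN.
Qed.

Lemma coad_linear_r xi : linear (coad G xi).
Proof.
move=> a mu nu; apply/matrixP => i j; rewrite !mxE.
by rewrite (pairing_linear_l (lb xi (delta_mx 0 i))) opprD mulrN.
Qed.

Lemma pairing_coad xi mu eta : pairing (coad G xi mu) eta = - pairing mu (lb xi eta).
Proof.
rewrite pairing_covector// => a u v.
by rewrite bracket_linear_r pairing_linear_r opprD scalerN.
Qed.

Lemma TTsG_of_triv_rep g mu xi nu :
  \forall z \near (chart ((g, mu), (xi, nu)) (((g, mu), (xi, nu)) : TTsG) : V4),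
  (z.1, (sigma g z.1.1 z.2.1, z.2.2 + coad G z.2.1 z.1.2)) =
  chart (@TTsG_of_triv R n G ((g, mu), (xi, nu)))
    (@TTsG_of_triv R n G (chart_inv (((g, mu), (xi, nu)) : TTsG) z)) :> V4.
Proof.
have N := @near_fst _ _ _ (fun y : V2 => exists2 q, chart_dom g q & y.1 = chart g q)
  ('c_g, mu) (xi, nu) (near_base_chart g mu).
apply: filterS N => -[[y m] [x k]] [q dq /= yE].
have cE : chart_inv (((g, mu), (xi, nu)) : TTsG) ((y, m), (x, k)) = (((q, m), (x, k)) : TTsG).
  by rewrite -[LHS]/((chart_inv g y, m), (x, k)) yE (chart_domK dq).
apply: etrans (congr1 (fun t : TTsG => chart (@TTsG_of_triv R n G ((g, mu), (xi, nu)))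
  (@TTsG_of_triv R n G t) : V4) (esym cE)).
transitivity (((chart g q, m), vector_coord ((g, mu) : GsD) (q, m) (TeR q x, k + coad G x m))
  : V4);
  last reflexivity.
by rewrite (vector_coord_GsD mu m _ dq) yE /sigma (chart_domK dq).
Qed.

Lemma tangent_TTsG_of_triv g mu xi nu (A dx : 'rV[R]_n) (dm dn : 'cV[R]_n) :
  tangent_map (@TTsG_of_triv R n G) (((g, mu), (xi, nu)) : TTsG) ((A, dm), (dx, dn)) =
  ((A, dm), ('d (fun y => sigma g y xi) 'c_g A + TeR g dx,
             dn + (coad G dx mu + coad G xi dm))).
Proof.
pose c : V4 := (('c_g, mu), (xi, nu)).
have d1 := is_diff_fst c; have d2 := is_diff_snd c.
have d11 := is_diff_comp d1 (is_diff_fst c.1); have d12 := is_diff_comp d1 (is_diff_snd c.1).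
have d21 := is_diff_comp d2 (is_diff_fst c.2); have d22 := is_diff_comp d2 (is_diff_snd c.2).
have ds := is_diff_sigma (erefl 'c_g : (fst \o fst) c = 'c_g) d11 d21.
have dc := is_diff_bilin coad_linear_l coad_linear_r d21 d12.
have H := is_diff_pair d1 (is_diff_pair ds (is_diffD d22 dc)).
have [_ e] := is_diff_near (TTsG_of_triv_rep g mu xi nu) H.
exact: (congr1 (fun f : V4 -> V4 => f ((A, dm), (dx, dn))) e).
Qed.

Lemma bracketDl a b c : lb (a + b) c = lb a c + lb b c.
Proof. by have := @bracket_linear_l _ _ G c 1 a b; rewrite !scale1r. Qed.

Lemma bracketDr a b c : lb a (b + c) = lb a b + lb a c.
Proof. by have := @bracket_linear_r _ _ G a 1 b c; rewrite !scale1r. Qed.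

(* With [dx] the variation of [xi = rho (V)] along [A]: it differs from the variation of
   [rho (A)] along [V] by [(d rho)(V, A) = [xi, rho A]]. *)
Lemma lift_velocity g xi A dx :
  'd (fun y => rho g y A) 'c_g (TeR g xi)
    + TRV g ('d (fun y => sigma g y xi) 'c_g A + TeR g dx)
  = lb xi (TRV g A) + dx.
Proof.
have E : TRV g ('d (fun y => sigma g y xi) 'c_g A + TeR g dx) =
    TRV g ('d (fun y => sigma g y xi) 'c_g A) + dx.
  have := @TRV_linear _ _ _ g 1 ('d (fun y => sigma g y xi) 'c_g A) (TeR g dx).
  by rewrite !scale1r TRV_TeR.
apply: etrans (congr1 (+%R _) E) _; rewrite addrA.
apply: (congr1 (fun t : 'rV[R]_n => t + dx)).
have E1 := etrans (maurer_cartan g (TeR g xi) A) (congr1 (lb ^~ (TRV g A)) (TRV_TeR g xi)).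
have E2 : TRV g ('d (fun y => sigma g y xi) 'c_g A) = - 'd (fun y => rho g y (TeR g xi)) 'c_g A.
  by apply/eqP; rewrite -addr_eq0 addrC; apply/eqP; exact: diff_rho_sigma.
apply: etrans E1; exact: (congr1 (fun t : 'rV[R]_n => _ + t) E2).
Qed.

Lemma Omega_TTsGE g mu xi nu (A dx A' dx' : 'rV[R]_n) (dm dn dm' dn' : 'cV[R]_n) :
  Omega_TTsG (((g, mu), (xi, nu)) : TTsG) ((A, dm), (dx, dn)) ((A', dm'), (dx', dn')) =
  pairing dn (TRV g A') - pairing dn' (TRV g A) + pairing nu (lb (TRV g A) (TRV g A'))
  + pairing dm dx' - pairing dm' dx.
Proof.
rewrite /Omega_TTsG /pullback2 !tangent_TTsG_of_triv /complete_lift.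
apply: etrans (congr2 +%R (congr2 +%R (derive_form2_GsD _ _ _ _ _) (Omega_GsDE _ _ _))
  (Omega_GsDE _ _ _)) _.
exact: lifted_form_algebra bracketDl bracketDr (bracket_anti G) (jacobi G) pairing_coad
  (lift_velocity g xi A dx) (lift_velocity g xi A' dx').
Qed.

End TulczyjewForm.

(** * The reduction *)

Section Continuity.
Context {T T1 T2 : topologicalType}.

Lemma continuous_pair (f : T -> T1) (g : T -> T2) :
  continuous f -> continuous g -> continuous (fun x => (f x, g x)).
Proof. by move=> cf cg x; apply: cvg_pair; [exact: cf|exact: cg]. Qed.

Lemma continuous_fst (f : T -> T1 * T2) : continuous f -> continuous (fun x => (f x).1).
Proof. by move=> cf x; apply: (continuous_comp (cf x)); exact: cvg_fst. Qed.

Lemma continuous_snd (f : T -> T1 * T2) : continuous f -> continuous (fun x => (f x).2).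
Proof. by move=> cf x; apply: (continuous_comp (cf x)); exact: cvg_snd. Qed.

Lemma continuous_const (t : T1) : continuous (fun _ : T => t).
Proof. by move=> x; exact: cvg_cst. Qed.

Lemma continuous_idmap : continuous (fun x : T => x).
Proof. by move=> x; exact: cvg_id. Qed.

End Continuity.

Lemma continuous_addf (R : realType) (T : topologicalType) (V : normedModType R)
    (f g : T -> V) :
  continuous f -> continuous g -> continuous (fun x => f x + g x).
Proof. by move=> cf cg x; exact: (continuousD (cf x) (cg x)). Qed.

Lemma continuous_oppf (R : realType) (T : topologicalType) (V : normedModType R)
    (f : T -> V) :
  continuous f -> continuous (fun x => - f x).
Proof. by move=> cf x; exact: (continuousN (cf x)). Qed.

(** * Maps that are affine in charts *)

Section AffineInCharts.
Context {R : realType}.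

Lemma open_prod_image (T1 T2 : topologicalType) (A : set T1) (B : set T2) :
  open A -> open B -> open (A `*` B).
Proof.
rewrite !openE => oA oB [x y] [/= Ax By]; exists (A, B) => //=.
by split; [exact: oA|exact: oB].
Qed.

Lemma open_chart_image_mx m n (p : 'M[R]_(m, n)) :
  open (chart p @` chart_dom p : set 'M[R]_(m, n)).
Proof.
rewrite (_ : _ @` _ = setT); first exact: openT.
by apply/seteqP; split => // x _; exists x.
Qed.

Lemma open_chart_image_prod (E F : normedModType R) (M : topChartedType E)
    (N : topChartedType F) (p : M * N) :
  open (chart p.1 @` chart_dom p.1 : set E) -> open (chart p.2 @` chart_dom p.2 : set F) ->
  open (chart p @` chart_dom p : set (E * F)%type).
Proof.
move=> o1 o2; rewrite (_ : _ @` _ = (chart p.1 @` chart_dom p.1) `*`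
  (chart p.2 @` chart_dom p.2)).
  exact: open_prod_image.
apply/seteqP; split => [_ [[a b] [/= da db] <-]|[_ _] [/= [a da <-] [b db <-]]].
  by split; [exists a|exists b].
by exists (a, b).
Qed.

Section Maps.
Context {E F : normedModType R} {M : topChartedType E} {N : topChartedType F}
  {rM : regular_charts M}.
Variables (f : M -> N) (h l : E -> F).
Hypotheses (ll : linear l) (cl : continuous l) (hl : forall y, h y = h 0 + l y).
Hypothesis fh : forall p q : M, h (chart p q) = chart (f p) (f q).

Lemma affine_local_rep (p : M) (y : E) :
  (chart p @` chart_dom p) y -> h y = local_rep f p y.
Proof. by move=> [q dq <-]; rewrite /local_rep chart_domK. Qed.

(** The action, the momentum map, the inclusion of the level set and the projection each copy or
    drop the factor [G] and are affine on the vector spaces. One affine [h] thus represents such a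
    map in all distinguished charts. *)
Lemma smooth_map_affine : (forall p : M, open (chart p @` chart_dom p : set E)) ->
  continuous f -> smooth_map f.
Proof.
move=> oM cf; split=> // p k.
apply: (@Ck_sub _ _ _ _ (chart p @` chart_dom p)); first by move=> y [q [dq _] <-]; exists q.
by apply: (eq_Ck (oM p) (@affine_local_rep p)); exact: Ck_affine hl.
Qed.

Lemma tangent_map_affine (p : M) (v : E) : tangent_map f p v = l v.
Proof.
have N' : \forall y \near (chart p p : E), h y = local_rep f p y.
  by apply: filterS (near_chart_image p) => y; exact: affine_local_rep.
have [_ e] := is_diff_near N' (is_diff_affine (chart p p : E) ll cl hl).
exact: (congr1 (fun t : E -> F => t v) e).
Qed.

End Maps.
End AffineInCharts.

(** * The action, its level sets and the quotient *)

Section Reduction.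
Context {R : realType} {n : nat} (G : lieGroupType R n).

Local Notation GsD := (G * 'cV[R]_n)%type.
Local Notation V2 := ('rV[R]_n * 'cV[R]_n)%type.
Local Notation TTsG := ((G * 'cV[R]_n) * ('rV[R]_n * 'cV[R]_n))%type.
Local Notation V4 := (V2 * V2)%type.
Local Notation Lvl := (G * ('cV[R]_n * 'cV[R]_n))%type.
Local Notation VL := ('rV[R]_n * ('cV[R]_n * 'cV[R]_n))%type.
Local Notation psi := (@psi R n G).

Lemma psiE (x : 'cV[R]_n * TTsG) :
  psi x.1 x.2 = ((x.2.1.1, x.2.1.2 + x.1), x.2.2).
Proof. by case: x => l [[g mu] [xi nu]]. Qed.

Lemma level_inclE xi (y : Lvl) : level_incl xi y = ((y.1, y.2.1), (- xi, y.2.2)) :> TTsG.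
Proof. by case: y => g [mu nu]. Qed.

Lemma open_chart_imageG (p : G) : open (chart p @` chart_dom p : set 'rV[R]_n).
Proof. exact: chart_image_open. Qed.

Lemma open_chart_imageTTsG (p : TTsG) : open (chart p @` chart_dom p : set V4).
Proof.
apply: open_chart_image_prod; apply: open_chart_image_prod;
  by [exact: open_chart_imageG|exact: open_chart_image_mx].
Qed.

Lemma psi_smooth : smooth_map (fun x : 'cV[R]_n * TTsG => psi x.1 x.2).
Proof.
pose h (y : 'cV[R]_n * V4) : V4 := ((y.2.1.1, y.2.1.2 + y.1), y.2.2).
have fE : (fun x : 'cV[R]_n * TTsG => psi x.1 x.2) =
    (fun x => ((x.2.1.1, x.2.1.2 + x.1), x.2.2)).
  by apply/funext => x; exact: psiE.
rewrite fE; apply: (smooth_map_affine (h := h) (l := h)).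
- move=> a u v; rewrite /h; apply: congr2 => //; apply: congr2 => //=.
  by rewrite scalerDr addrACA.
- exact: (continuous_pair (continuous_pair
    (continuous_fst (continuous_fst (continuous_snd (@continuous_idmap _))))
    (continuous_addf (continuous_snd (continuous_fst (continuous_snd (@continuous_idmap _))))
      (continuous_fst (@continuous_idmap _))))
    (continuous_snd (continuous_snd (@continuous_idmap _)))).
- move=> [l [[y m] [x k]]].
  rewrite -[RHS]/(((0 + y, (0 + 0) + (m + l)), (0 + x, 0 + k)) : V4) !add0r; reflexivity.
- by [].
- move=> p; apply: open_chart_image_prod; first exact: open_chart_image_mx.
  exact: open_chart_imageTTsG.
- exact: (continuous_pair (continuous_pair
    (continuous_fst (continuous_fst (continuous_snd (@continuous_idmap _))))
    (continuous_addf (continuous_snd (continuous_fst (continuous_snd (@continuous_idmap _))))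
      (continuous_fst (@continuous_idmap _))))
    (continuous_snd (continuous_snd (@continuous_idmap _)))).
Qed.

Lemma tangent_psi lambda (p : TTsG) (v : V4) : tangent_map (psi lambda) p v = v.
Proof.
pose h (y : V4) : V4 := ((y.1.1, y.1.2 + lambda), y.2).
apply: (tangent_map_affine (h := h) (l := id)).
- by [].
- exact: continuous_idmap.
- move=> [[y m] [x k]]; rewrite /h /=; rewrite -[RHS]/((0 + y, 0 + lambda + m), (0 + x, 0 + k)).
  by rewrite !add0r addrC.
- by move=> [[g mu] [xi nu]] [[q m] [x k]].
Qed.

Lemma open_chart_imageLvl (p : Lvl) : open (chart p @` chart_dom p : set VL).
Proof.
apply: open_chart_image_prod; first exact: open_chart_imageG.
by apply: open_chart_image_prod; exact: open_chart_image_mx.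
Qed.

Definition level_h xi (y : VL) : V4 := ((y.1, y.2.1), (- xi, y.2.2)).
Definition level_l (y : VL) : V4 := ((y.1, y.2.1), (0, y.2.2)).

Lemma level_l_linear : linear level_l.
Proof.
move=> a u v; rewrite /level_l -[RHS]/((_, _), (a *: 0 + 0, _)) scaler0 addr0; reflexivity.
Qed.

Lemma level_l_continuous : continuous level_l.
Proof.
exact: (continuous_pair (continuous_pair (continuous_fst (@continuous_idmap VL))
    (continuous_fst (continuous_snd (@continuous_idmap VL))))
  (continuous_pair (@continuous_const VL _ (0 : 'rV[R]_n))
    (continuous_snd (continuous_snd (@continuous_idmap VL))))).
Qed.

Lemma level_h_affine xi y : level_h xi y = level_h xi 0 + level_l y.
Proof.
case: y => y [m k].
rewrite -[RHS]/(((0 + y, 0 + m), (- xi + 0, 0 + k)) : V4) !add0r addr0; reflexivity.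
Qed.

Lemma level_h_rep xi (p q : Lvl) :
  level_h xi (chart p q) = chart ((@level_incl R n G xi) p) ((@level_incl R n G xi) q).
Proof. by case: p q => [g [mu nu]] [h [m k]]. Qed.

Lemma level_incl_continuous xi : continuous (@level_incl R n G xi : Lvl -> TTsG).
Proof.
have -> : (@level_incl R n G xi) = (fun y => ((y.1, y.2.1), (- xi, y.2.2))).
  by apply/funext => y; exact: level_inclE.
exact: (continuous_pair (continuous_pair (continuous_fst (@continuous_idmap Lvl))
    (continuous_fst (continuous_snd (@continuous_idmap Lvl))))
  (continuous_pair (@continuous_const Lvl _ (- xi : 'rV[R]_n))
    (continuous_snd (continuous_snd (@continuous_idmap Lvl))))).
Qed.

Lemma level_incl_smooth xi : smooth_map (@level_incl R n G xi : Lvl -> TTsG).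
Proof.
apply: (smooth_map_affine (h := level_h xi) (l := level_l)).
- exact: level_l_linear.
- exact: level_l_continuous.
- exact: level_h_affine.
- exact: level_h_rep.
- exact: open_chart_imageLvl.
- exact: level_incl_continuous.
Qed.

Lemma tangent_level_incl xi (p : Lvl) (v : VL) :
  tangent_map (@level_incl R n G xi : Lvl -> TTsG) p v = level_l v.
Proof.
apply: (tangent_map_affine (h := level_h xi)).
- exact: level_l_linear.
- exact: level_l_continuous.
- exact: level_h_affine.
- exact: level_h_rep.
Qed.

Definition momentum_l (y : V4) : 'rV[R]_n := - y.2.1.

Lemma momentum_l_linear : linear momentum_l.
Proof. by move=> a u v; rewrite /momentum_l /= opprD scalerN. Qed.

Lemma momentum_l_continuous : continuous momentum_l.
Proof. exact: (continuous_oppf (continuous_fst (continuous_snd (@continuous_idmap _)))). Qed.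

Lemma momentum_l_affine y : momentum_l y = momentum_l 0 + momentum_l y.
Proof. by rewrite -[X in X + _]/(- 0) oppr0 add0r. Qed.

Lemma momentum_rep (p q : TTsG) :
  momentum_l (chart p q) = chart (@J R n G p) (@J R n G q).
Proof. by []. Qed.

Lemma J_smooth : smooth_map (@J R n G).
Proof.
apply: (smooth_map_affine (h := momentum_l) (l := momentum_l)).
- exact: momentum_l_linear.
- exact: momentum_l_continuous.
- exact: momentum_l_affine.
- exact: momentum_rep.
- exact: open_chart_imageTTsG.
- exact: (continuous_oppf (continuous_fst (continuous_snd (@continuous_idmap _)))).
Qed.

Lemma tangent_J (p : TTsG) (v : V4) : tangent_map (@J R n G) p v = - v.2.1.
Proof.
apply: (tangent_map_affine (h := momentum_l) (l := momentum_l)).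
- exact: momentum_l_linear.
- exact: momentum_l_continuous.
- exact: momentum_l_affine.
- exact: momentum_rep.
Qed.

Definition quotient_map (y : Lvl) : GsD := (y.1, y.2.2).
Definition quotient_l (y : VL) : V2 := (y.1, y.2.2).

Lemma quotient_l_linear : linear quotient_l.
Proof. by []. Qed.

Lemma quotient_l_continuous : continuous quotient_l.
Proof.
exact: (continuous_pair (continuous_fst (@continuous_idmap _))
    (continuous_snd (continuous_snd (@continuous_idmap _)))).
Qed.

Lemma quotient_l_affine y : quotient_l y = quotient_l 0 + quotient_l y.
Proof. by rewrite -[X in X + _]/(0 : V2) add0r. Qed.

Lemma quotient_rep (p q : Lvl) :
  quotient_l (chart p q) = chart (quotient_map p) (quotient_map q).
Proof. by case: p q => [g [mu nu]] [h [m k]]. Qed.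

Lemma quotient_map_smooth : smooth_map quotient_map.
Proof.
apply: (smooth_map_affine (h := quotient_l) (l := quotient_l)).
- exact: quotient_l_linear.
- exact: quotient_l_continuous.
- exact: quotient_l_affine.
- exact: quotient_rep.
- exact: open_chart_imageLvl.
- exact: (continuous_pair (continuous_fst (@continuous_idmap _))
    (continuous_snd (continuous_snd (@continuous_idmap _)))).
Qed.

Lemma tangent_quotient_map (p : Lvl) (v : VL) :
  tangent_map quotient_map p v = (v.1, v.2.2).
Proof.
apply: (tangent_map_affine (h := quotient_l) (l := quotient_l)).
- exact: quotient_l_linear.
- exact: quotient_l_continuous.
- exact: quotient_l_affine.
- exact: quotient_rep.
Qed.

(** In the chart at [p] the orbit curve is the straight line [c + t *: v]. *)
Lemma psi_generator lambda (p : TTsG) :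
  infinitesimal_generator psi lambda p = ((0, lambda), (0, 0)) :> V4.
Proof.
case: p => [[g mu] [xi nu]]; rewrite /infinitesimal_generator derive1E.
pose v : V4 := ((0, lambda), (0, 0)).
pose c : V4 := ((chart g g, mu), (xi, nu)).
have H := is_diffD (is_diff_cst c (0 : R)) (is_diff_scalel (0 : R) v).
have N : \forall t \near (0 : R), (cst c + (fun t : R => t *: v)) t =
    chart (((g, mu), (xi, nu)) : TTsG) (psi (t *: lambda) ((g, mu), (xi, nu))) :> V4.
  apply: filterE => t.
  rewrite -[LHS]/(((chart g g + t *: 0, mu + t *: lambda), (xi + t *: 0, nu + t *: 0)) : V4).
  by rewrite !scaler0 !addr0.
have [df e] := is_diff_near N H.
rewrite (deriveE _ df); apply: etrans (congr1 (fun f : R -> V4 => f 1) e) _.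
by rewrite -[LHS]/(0 + 1 *: v) add0r scale1r.
Qed.

Lemma differential_momentum lambda (p : TTsG) (w : V4) :
  differential (fun q : TTsG => pairing lambda (@J R n G q)) p w = - pairing lambda w.2.1.
Proof.
pose f (y : V4) : R := pairing lambda (- y.2.1).
have lf : linear f.
  by move=> a u v; rewrite /f /= opprD -scalerN pairing_linear_r.
have cf : continuous f.
  move=> y; apply: (@continuous_comp _ _ _ (fun y : V4 => - y.2.1)
    (pairing lambda : 'rV[R]_n -> R)).
    exact: momentum_l_continuous.
  exact: (linear_mx_continuous (pairing_linear_r lambda)).
have [_ e] := is_diff_linear (chart p p : V4) lf cf.
apply: etrans (congr1 (fun f : V4 -> R => f w) e) _.
by rewrite /f pairingNr.
Qed.

Lemma lie_bracket0l eta : lie_bracket G 0 eta = 0.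
Proof.
by have := linear_scaleE 0 0 (@bracket_linear_l _ _ G eta); rewrite !scale0r.
Qed.

Lemma TRV0 (g : G) : TRV g 0 = 0.
Proof. by have := linear_scaleE 0 0 (@TRV_linear _ _ _ g); rewrite !scale0r. Qed.

(** In distinguished charts the tangent map of a translation is the identity, and [mu] does not
    occur in [Omega_TTsGE]. *)
Lemma psi_symplectic lambda :
  pullback2 (psi lambda) (@Omega_TTsG R n G) = @Omega_TTsG R n G.
Proof.
apply/funext => p; apply/funext => u; apply/funext => w.
rewrite /pullback2 !tangent_psi.
case: p u w => [[g mu] [xi nu]] [[A dm] [dx dn]] [[A' dm'] [dx' dn']].
exact: (etrans (Omega_TTsGE _ _ _ _ _ _ _ _ _ _ _ _) (esym
  (Omega_TTsGE _ _ _ _ _ _ _ _ _ _ _ _))).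
Qed.

(** The generator has [lambda] as its only nonzero component, in the slot of [mu], so of the whole
    form just [<lambda, dx>] survives; the two minus signs on the right cancel. *)
Lemma psi_momentum : is_momentum_map (@Omega_TTsG R n G) psi (@J R n G).
Proof.
split; first exact: J_smooth.
move=> lambda p w; rewrite psi_generator differential_momentum opprK.
case: p w => [[g mu] [xi nu]] [[A dm] [dx dn]].
apply: etrans (Omega_TTsGE _ _ _ _ _ _ _ _ _ _ _ _) _.
by rewrite TRV0 lie_bracket0l !pairing0l !pairing0r !subr0 !add0r.
Qed.

Lemma psi_action : is_smooth_action psi.
Proof.
split; last exact: psi_smooth.
- by move=> [[g mu] [xi nu]]; rewrite /psi addr0.
- by move=> l m [[g mu] [xi nu]]; rewrite /psi addrA addrAC.
Qed.

(** Every point of an orbit gives the same value, since [psi] moves only [mu]. The default of [xget]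
    concerns the empty set, which is not an orbit. *)
Definition orbit_class (S : set TTsG) : GsD :=
  let p := xget (((1%g : G, 0), (0, 0)) : TTsG) S in (p.1.1, p.2.2).

Lemma orbit_classE (p : TTsG) : orbit_class (orbit_of psi p) = (p.1.1, p.2.2).
Proof.
rewrite /orbit_class; have [l _ <-] : orbit_of psi p (xget (((1%g : G, 0), (0, 0)) : TTsG)
  (orbit_of psi p)).
  by apply: xgetPex; exists (psi 0 p), 0.
by case: p => [[g mu] [xi nu]].
Qed.

Lemma quotient_mapE xi :
  (fun x : Lvl => orbit_class (orbit_of psi (level_incl xi x))) = quotient_map.
Proof. by apply/funext => -[g [mu nu]]; rewrite orbit_classE. Qed.

Lemma level_set xi : range (@level_incl R n G xi) = @J R n G @^-1` [set xi].
Proof.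
apply/seteqP; split => [_ [[g [mu nu]] _ <-]|[[g mu] [x nu]]]; rewrite /J /=.
  exact: opprK.
by move=> <-; exists (g, (mu, nu)) => //; rewrite /= opprK.
Qed.

Lemma orbit_class_bij xi :
  set_bij (reduced_space psi (@J R n G) xi) setT orbit_class.
Proof.
split.
- by [].
- move=> _ _ /set_mem[p Jp <-] /set_mem[q Jq <-]; rewrite !orbit_classE.
  case: p q Jp Jq => [[g mu] [x nu]] [[g' mu'] [x' nu']].
  rewrite /J /= => <- /oppr_inj -> [-> ->].
  apply/seteqP; split => _ [l _ <-].
    (* Both points agree except for [mu] and [mu']; the shift by [mu - mu'] makes up the
       difference. *)
    by exists (l + mu - mu') => //=; rewrite addrC subrK addrC.
  by exists (l + mu' - mu) => //=; rewrite addrC subrK addrC.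
- move=> [g nu] _; exists (orbit_of psi ((g, 0), (- xi, nu))); last by rewrite orbit_classE.
  by exists ((g, 0), (- xi, nu)) => //; rewrite /J /= opprK.
Qed.

Lemma psi_reduction xi :
  is_symplectic_reduction (@Omega_TTsG R n G) psi (@J R n G) xi
    (@level_incl R n G xi) orbit_class (@Omega_GsD R n G).
Proof.
split.
- by move=> l [[g mu] [x nu]].
(* The tangent map of [J] is minus the projection to the component of [xi]. *)
- by move=> p _ v; exists ((0, 0), (- v, 0)); rewrite tangent_J opprK.
- exact: level_incl_smooth.
- by move=> [g [mu nu]] [g' [mu' nu']] [-> -> ->].
- exact: level_set.
- move=> U oU; pose r (p : TTsG) : Lvl := (p.1.1, (p.1.2, p.2.2)).
  have cr : continuous r.
    exact: (continuous_pair (continuous_fst (continuous_fst (@continuous_idmap _)))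
      (continuous_pair (continuous_snd (continuous_fst (@continuous_idmap _)))
        (continuous_snd (continuous_snd (@continuous_idmap _))))).
  exists (r @^-1` U); first exact: ((continuousP _).1 cr).
  by apply/seteqP; split => -[g [mu nu]].
- move=> x [u1 [u2 u3]] [v1 [v2 v3]]; rewrite !tangent_level_incl.
  by move=> [-> -> ->].
- exact: orbit_class_bij.
- by rewrite quotient_mapE; exact: quotient_map_smooth.
(* The direction of [mu] is vertical, so its component in the lift is free; 0 is taken. *)
- move=> x [v1 v2]; exists (v1, (0, v2)).
  by rewrite quotient_mapE tangent_quotient_map.
- rewrite quotient_mapE; apply/funext => x; apply/funext => u; apply/funext => w.
  rewrite /pullback2 !tangent_level_incl !tangent_quotient_map Omega_GsDE.
  case: x u w => g [mu nu] [A [dm dn]] [A' [dm' dn']].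
  apply: etrans (Omega_TTsGE _ _ _ _ _ _ _ _ _ _ _ _) _.
  by rewrite !pairing0r addr0 subr0.
Qed.

End Reduction.

Theorem proposition6p13 (R : realType) (n : nat) (G : lieGroupType R n) :
  (* psi is a symplectic action with momentum map J *)
  [/\ is_smooth_action (@psi R n G),
      forall lambda, pullback2 (psi lambda) (@Omega_TTsG R n G) = @Omega_TTsG R n G
    & is_momentum_map (@Omega_TTsG R n G) (@psi R n G) (@J R n G)] /\
  (* J^-1(xi) / g_1^* ~ G (s) (g_1^* x g_3^* ) / g_1^* ~ (G (s) g_3^*, Omega) *)
  forall xi : 'rV[R]_n,
    (forall lambda (y : G * ('cV[R]_n * 'cV[R]_n)),
       level_incl xi (psi_level lambda y) = psi lambda (level_incl xi y)) /\
    exists Phi : set ((G * 'cV[R]_n) * ('rV[R]_n * 'cV[R]_n)) -> G * 'cV[R]_n,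
      (forall g mu nu,
         Phi (orbit_of (@psi R n G) ((g, mu), (- xi, nu))) = (g, nu)) /\
      is_symplectic_reduction (@Omega_TTsG R n G) (@psi R n G) (@J R n G) xi
        (@level_incl R n G xi) Phi (@Omega_GsD R n G).
Proof.
split; first by split; [exact: psi_action|exact: psi_symplectic|exact: psi_momentum].
move=> xi; split; first by move=> lambda [g [mu nu]].
exists (@orbit_class R n G); split; last exact: psi_reduction.
by move=> g mu nu; rewrite orbit_classE.
Qed.
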